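(* Let $\nu,\hat\nu,\mu>0$, $N\in\mathbb{N}$, $f\in H$. Let $u_*\in D(A)$ satisfy $\nu Au_*+B(u_*,u_* )=f$, let $v_*\in D(A)$, $v_*\ne0$, satisfy $\hat\nu Av_*+B(v_*,v_* )+\mu P_Nv_*=f+\mu P_Nu_*$, and let $\hat v_*$ satisfy $\hat\nu A\hat v_*+\mu P_N\hat v_*+DB(v_* )\hat v_*=-Av_*$. Suppose $$\mu\ge\max\left\{\frac{32c_L^2\|v_*\|^2}{\hat\nu},\ \frac{16c_{BG}^2\|v_*\|^2}{\hat\nu}\left[1+\log\left(\frac{|Av_*|}{|v_*|}\right)\right]\right\},$$ $$N\ge\max\left\{\frac{8c_L\|v_*\|}{\hat\nu},\ \frac{4c_{BG}\|v_*\|}{\hat\nu}\left[1+\log\left(\frac{|Av_*|}{|v_*|}\right)\right]^{1/2}\right\}.$$ Then, with $\mathsf{P}_*(\hat\nu):=-(Av_*,\hat v_* )$ and $L_\mu:=\hat\nu A+\mu P_N$, $$\mathsf{P}_*(\hat\nu)\ge\frac13\,(Av_*,L_\mu^{-1}Av_* ).$$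
   Context: Setting: $\mathbb{T}^2=[0,2\pi]^2$ with periodic boundary conditions. $H$ is the space of mean-free, divergence-free vector fields in $L^2(\mathbb{T}^2)$ with inner product $(\cdot,\cdot)$ and norm $|\cdot|$; $V=H^1\cap H$ with norm $\|u\|=|\nabla u|$; $P_\sigma$ is the Leray projection, $A=P_\sigma(-\Delta)=-\Delta$ with domain $D(A)=H^2\cap V$; $B(u,v)=P_\sigma((u\cdot\nabla)v)$; $DB(v)\phi=B(v,\phi)+B(\phi,v)$. $P_N$ is the $L^2$-orthogonal projection onto Fourier wavenumbers $|k|\le N$. $c_L$ is the constant in Ladyzhenskaya's inequality $|\phi|_{L^4}^2\le c_L\|\phi\||\phi|$ and $c_{BG}$ the constant in the Brézis–Gallouet inequality $|\phi|_{L^\infty}\le c_{BG}\|\phi\|\left[1+\log(|A\phi|/\|\phi\|)\right]^{1/2}$ for $\phi\in D(A)$. *)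

(* Defs.v *)
From HB Require Import structures.
From mathcomp Require Import all_boot all_order all_algebra.
From mathcomp Require Import all_classical all_reals all_analysis.
Set Implicit Arguments.
Unset Strict Implicit.
Unset Printing Implicit Defensive.
Import Order.TTheory GRing.Theory Num.Theory.
Import numFieldNormedType.Exports.
Local Open Scope classical_set_scope.
Local Open Scope ring_scope.

(* Only the values on [0, 2 pi]^2 matter, and only almost everywhere there
   (equality of fields is [vae]); the periodic boundary conditions enter through
   the periodic test functions that define weak derivatives and divergence. *)
Definition sfield (R : realType) := (R * R)%type -> R.
Definition vfield (R : realType) := 'I_2 -> sfield R.

Definition side (R : realType) : set R := `[0, 2 * pi].

Lemma measurable_side (R : realType) :
  measurable (@side R : set (measurableTypeR R)).
Proof. exact: measurable_itv. Qed.

Lemma side_finite (R : realType) :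
  (lebesgue_measure (@side R : set (measurableTypeR R)) < +oo)%E.
Proof. by rewrite lebesgue_measure_itv /=; case: ifP => _; rewrite ltry. Qed.

Definition lebesgue_side (R : realType) :
    {finite_measure set (measurableTypeR R) -> \bar R} :=
  mfrestr (@measurable_side R) (@side_finite R).

Definition torus (R : realType) :
    {measure set (measurableTypeR R * measurableTypeR R)%type -> \bar R} :=
  (lebesgue_side R \x lebesgue_side R)%E.

Section Torus.
Variable R : realType.
Implicit Types (f g psi : sfield R) (u v w phi : vfield R).
Local Notation mu := (torus R).

Definition coord (j : 'I_2) (x : R * R) : R := if j == ord0 then x.1 else x.2.
Definition dir (j : 'I_2) : R * R := if j == ord0 then (1, 0) else (0, 1).

Fixpoint Ck (n : nat) psi : Prop :=
  continuous psi /\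
  if n is n'.+1 then
    forall j, (forall x, derivable psi x (dir j)) /\ Ck n' ('D_(dir j) psi)
  else True.

Definition test_function psi : Prop :=
  (forall n, Ck n psi) /\
  (forall x j, psi (x + (2 * pi) *: dir j) = psi x).

Definition integ f : R := \int[mu]_x f x.

Definition L2 f : Prop := f \in Lfun mu 2%:E.

Definition weak_derivative (j : 'I_2) f g : Prop :=
  L2 g /\ forall psi, test_function psi ->
    integ (fun x => f x * 'D_(dir j) psi x) = - integ (fun x => g x * psi x).

Definition weakly_derivable f : Prop := forall j, exists g, weak_derivative j f g.

Definition wD (j : 'I_2) f : sfield R := xget (cst 0) [set g | weak_derivative j f g].

Definition vae u v : Prop := forall i, u i = v i %[ae mu].

Definition vL2 u : Prop := forall i, L2 (u i).

Definition ip u v : R := integ (fun x => \sum_i u i x * v i x).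

Definition normH u : R := Num.sqrt (ip u u).

Definition normV u : R :=
  Num.sqrt (\sum_i \sum_j integ (fun x => wD j (u i) x ^+ 2)).

Definition euclid u (x : R * R) : R := Num.sqrt (\sum_i u i x ^+ 2).

(* The norm of L^p(T^2) for vector fields, with the Euclidean length of u(x). *)
Definition normLp (p : \bar R) u : \bar R := 'N[mu]_p [EFin \o euclid u]%E.

Definition inH u : Prop :=
  [/\ vL2 u, forall i, integ (u i) = 0 &
      forall psi, test_function psi ->
        integ (fun x => \sum_j u j x * 'D_(dir j) psi x) = 0].

Definition inV u : Prop := inH u /\ forall i, weakly_derivable (u i).

Definition inDA u : Prop :=
  inV u /\ forall i j, weakly_derivable (wD j (u i)).

(* On D(A) the Leray projection is not needed: P(-Delta) = -Delta. *)
Definition stokes u : vfield R := fun i x => - \sum_j wD j (wD j (u i)) x.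

(* The graph of the Leray projection: v is the L^2-orthogonal projection of u
   on H, which determines v almost everywhere. *)
Definition leray u v : Prop :=
  [/\ vL2 u, inH v & forall phi, inH phi -> ip (u - v) phi = 0].

Definition advection u v : vfield R := fun i x => \sum_j u j x * wD j (v i) x.

Definition isB u v b : Prop := leray (advection u v) b.

Definition isDB v phi b : Prop :=
  exists b1 b2, [/\ isB v phi b1, isB phi v b2 & vae b (b1 + b2)].

(* The ordinal pair k encodes the wavenumber (k.1 - N, k.2 - N), so that both
   components range over -N, .., N. *)
Definition wave N (k : 'I_N.*2.+1 * 'I_N.*2.+1) (j : 'I_2) : R :=
  (if j == ord0 then k.1 else k.2)%:R - N%:R.

Definition phase N (k : 'I_N.*2.+1 * 'I_N.*2.+1) (x : R * R) : R :=
  \sum_j wave k j * coord j x.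

(* The sum over |k| <= N of the Fourier terms (2 pi)^-2 (u_i, e^(ik.y)) e^(ik.x),
   in real form: the imaginary parts of the k and -k terms cancel. *)
Definition PN (N : nat) u : vfield R := fun i x =>
  \sum_(k : 'I_N.*2.+1 * 'I_N.*2.+1 | \sum_j wave k j ^+ 2 <= N%:R ^+ 2)
    ((2 * pi) ^- 2 * integ (fun y => u i y * cos (phase k y)) * cos (phase k x) +
     (2 * pi) ^- 2 * integ (fun y => u i y * sin (phase k y)) * sin (phase k x)).

Definition Lmu (hnu m : R) (N : nat) u : vfield R :=
  hnu *: stokes u + m *: PN N u.

Definition Lmu_inv (hnu m : R) (N : nat) u : vfield R :=
  xget (fun=> cst 0) [set z : vfield R | inDA z /\ vae (Lmu hnu m N z) u].

Definition ladyzhenskaya (cL : R) : Prop := forall phi, inV phi ->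
  (normLp 4%:E phi ^+ 2 <= (cL * normV phi * normH phi)%:E)%E.

Definition brezis_gallouet (cBG : R) : Prop := forall phi, inDA phi ->
  (normLp +oo phi <=
   (cBG * normV phi * Num.sqrt (1 + ln (normH (stokes phi) / normV phi)))%:E)%E.

End Torus.

(* Main.v *)
(** Put g = A v, L = hnu A + m P_N, z = L^-1 g, and write |.|_L for the energy norm
    of L. Testing L w + DB(v) w = - g against w and against z gives
    P = |w|_L^2 + (DB(v) w, w) and P = |z|_L^2 + (DB(v) w, z). Each trilinear term is
    absorbed: |(B(v,w),phi)| <= |v|_oo ||w|| |phi| <= 1/4 |w|_L |phi|_L by
    Brezis-Gallouet, and |(B(w,v),phi)| <= 3/16 |w|_L |phi|_L by Ladyzhenskaya, where
    |phi| is controlled by |phi|_L through |phi|^2 <= (P_N phi, phi) + N^-2 ||phi||^2.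
    Since the total 7/16 is small, the cancellation (B(v,w),w) = 0 is not needed:
    P >= 9/16 |w|_L^2 and P >= |z|_L^2 - 7/32 (|w|_L^2 + |z|_L^2) give
    P >= |z|_L^2 / 3.

    The spectral gap inequality, Poincare's inequality and (A u, w) = (grad u, grad w)
    for weak derivatives all follow from Parseval's identity on the torus. For that,
    the sets whose indicator function is an L^2 limit of trigonometric polynomials
    form a sigma-algebra, which contains the superlevel sets of trigonometric
    polynomials and hence all Borel sets up to null sets. *)
Require Import Defs.
From mathcomp Require Import all_boot all_order all_algebra.
From mathcomp Require Import all_classical all_reals all_analysis.
From mathcomp Require Import measurable_realfun ess_sup_inf ring lra.
Import Order.TTheory GRing.Theory Num.Theory.
Import numFieldNormedType.Exports.
Set Implicit Arguments.
Unset Strict Implicit.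
Unset Printing Implicit Defensive.
Local Open Scope classical_set_scope.
Local Open Scope ring_scope.

(** * The inner product of L2 *)

Section SquareIntegrable.
Context d (T : measurableType d) (R : realType).
Variable mu : {measure set T -> \bar R}.
Implicit Types f g h : T -> R.

(** The lower bounds on [mu] and on [N] control low and high modes separately, so that
    [32 cL^2 ||v||^2 |phi|^2] and [16 b^2 |phi|^2], with [b] the Brezis-Gallouet bound on [|v|_oo],
    are both at most [hnu |phi|_L^2]. Combined with [hnu ||w||^2 <= |w|_L^2], the second gives the
    factor [1/4 = 16^(-1/2)] and the first gives [32^(-1/2)], rounded up to the rational 3/16. Two
    obstacles shape the rest. Weak derivatives are tested only against smooth periodic functions,
    which says nothing directly about the pairing of two weakly differentiable fields; but cosines
    and sines are test functions, so differentiation acts on Fourier coefficients as a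
    multiplication, and Parseval's identity carries the result back to L2. In the proof of density,
    periodic functions cannot tell 0 from [2 * pi], so half-lines are recovered only up to the null
    edges of the square. *)

Definition dotp f g : R := \int[mu]_x (f x * g x).

Lemma measurable_Lfun p f : f \in Lfun mu p -> measurable_fun setT f.
Proof. by rewrite inE => /andP[]; rewrite inE. Qed.

Lemma Lfun2P f : f \in Lfun mu 2%:E <->
  measurable_fun setT f /\ mu.-integrable setT (EFin \o (fun x => f x ^+ 2)).
Proof.
split=> [Lf|[mf /integrableP[_ If]]].
  by split; [exact: measurable_Lfun Lf | exact: Lfun2_integrable_sqr].
rewrite inE; apply/andP; split; rewrite inE //= /finite_norm unlock.
rewrite poweR_lty //; apply: le_lt_trans If; rewrite le_eqVlt; apply/orP; left.
apply/eqP; apply: eq_integral => x _ /=.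
by rewrite powR_mulrn ?normr_ge0 // normrX.
Qed.

Lemma Lfun2_add f g : f \in Lfun mu 2%:E -> g \in Lfun mu 2%:E ->
  (fun x => f x + g x) \in Lfun mu 2%:E.
Proof. by move=> Lf Lg; apply: (@rpredD _ (Lfun mu 2%:E)); rewrite ?lee1n. Qed.

Lemma Lfun2_scale a f : f \in Lfun mu 2%:E ->
  (fun x => a * f x) \in Lfun mu 2%:E.
Proof. by move=> Lf; apply: (@rpredZ _ _ (Lfun mu 2%:E)); rewrite ?lee1n. Qed.

Lemma Lfun2_opp f : f \in Lfun mu 2%:E -> (fun x => - f x) \in Lfun mu 2%:E.
Proof.
move=> Lf; rewrite (_ : (fun x => - f x) = (fun x => -1 * f x)).
  exact: Lfun2_scale.
by apply/funext => x; rewrite mulN1r.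
Qed.

Lemma Lfun2_sub f g : f \in Lfun mu 2%:E -> g \in Lfun mu 2%:E ->
  (fun x => f x - g x) \in Lfun mu 2%:E.
Proof. by move=> Lf /Lfun2_opp; exact: Lfun2_add. Qed.

Lemma Lfun2_0 : (fun=> 0) \in Lfun mu 2%:E.
Proof. by apply: (@rpred0 _ (Lfun mu 2%:E)); rewrite ?lee1n. Qed.

Lemma Lfun2_sum (I : Type) (s : seq I) (P : pred I) (F : I -> T -> R) :
  (forall i, P i -> F i \in Lfun mu 2%:E) ->
  (fun x => \sum_(i <- s | P i) F i x) \in Lfun mu 2%:E.
Proof.
move=> LF; elim: s => [|i s IH].
  by under eq_fun do rewrite big_nil; exact: Lfun2_0.
under eq_fun do rewrite big_cons.
by case: (P i) (LF i) => // /(_ isT) LFi; exact: Lfun2_add.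
Qed.

Lemma integrable_mul f g : f \in Lfun mu 2%:E -> g \in Lfun mu 2%:E ->
  mu.-integrable setT (EFin \o (fun x => f x * g x)).
Proof. by move=> Lf Lg; apply/Lfun1_integrable; exact: Lfun2_mul_Lfun1. Qed.

Lemma Lfun2_le f g : measurable_fun setT f -> (forall x, `|f x| <= g x) ->
  g \in Lfun mu 2%:E -> f \in Lfun mu 2%:E.
Proof.
move=> mf fg /Lfun2P [mg Ig]; apply/Lfun2P; split=> //.
apply: le_integrable Ig => //.
  by apply/measurable_EFinP; exact: measurable_funX.
move=> x _ /=; rewrite lee_fin !normrX ler_pXn2r ?nnegrE ?normr_ge0 //.
by rewrite (le_trans (fg x)) // ler_norm.
Qed.

Lemma dotpC f g : dotp f g = dotp g f.
Proof. by apply: eq_Rintegral => x _; rewrite mulrC. Qed.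

Lemma dotpDl f g h : f \in Lfun mu 2%:E -> g \in Lfun mu 2%:E ->
  h \in Lfun mu 2%:E -> dotp (fun x => f x + g x) h = dotp f h + dotp g h.
Proof.
move=> Lf Lg Lh; rewrite /dotp -RintegralD //; try exact: integrable_mul.
by apply: eq_Rintegral => x _; rewrite mulrDl.
Qed.

Lemma dotpZl a f h : f \in Lfun mu 2%:E -> h \in Lfun mu 2%:E ->
  dotp (fun x => a * f x) h = a * dotp f h.
Proof.
move=> Lf Lh; rewrite /dotp -RintegralZl //; last exact: integrable_mul.
by apply: eq_Rintegral => x _; rewrite mulrA.
Qed.

Lemma dotpNl f h : f \in Lfun mu 2%:E -> h \in Lfun mu 2%:E ->
  dotp (fun x => - f x) h = - dotp f h.
Proof.
move=> Lf Lh; rewrite -mulN1r -dotpZl //.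
by apply: eq_Rintegral => x _; rewrite mulN1r.
Qed.

Lemma dotpBl f g h : f \in Lfun mu 2%:E -> g \in Lfun mu 2%:E ->
  h \in Lfun mu 2%:E -> dotp (fun x => f x - g x) h = dotp f h - dotp g h.
Proof. by move=> Lf Lg Lh; rewrite dotpDl ?dotpNl //; exact: Lfun2_opp. Qed.

Lemma dotpDr f g h : f \in Lfun mu 2%:E -> g \in Lfun mu 2%:E ->
  h \in Lfun mu 2%:E -> dotp h (fun x => f x + g x) = dotp h f + dotp h g.
Proof. by move=> *; rewrite dotpC dotpDl // !(dotpC h). Qed.

Lemma dotpZr a f h : f \in Lfun mu 2%:E -> h \in Lfun mu 2%:E ->
  dotp h (fun x => a * f x) = a * dotp h f.
Proof. by move=> *; rewrite dotpC dotpZl // (dotpC h). Qed.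

Lemma dotpBr f g h : f \in Lfun mu 2%:E -> g \in Lfun mu 2%:E ->
  h \in Lfun mu 2%:E -> dotp h (fun x => f x - g x) = dotp h f - dotp h g.
Proof. by move=> *; rewrite dotpC dotpBl // !(dotpC h). Qed.

Lemma dotp0l h : dotp (fun=> 0) h = 0.
Proof.
rewrite /dotp (_ : (fun x => 0 * h x) = cst 0).
  by rewrite Rintegral_cst // mul0r.
by apply/funext => x; rewrite mul0r.
Qed.

Lemma dotp_suml (I : Type) (s : seq I) (P : pred I) (F : I -> T -> R) h :
  (forall i, P i -> F i \in Lfun mu 2%:E) -> h \in Lfun mu 2%:E ->
  dotp (fun x => \sum_(i <- s | P i) F i x) h = \sum_(i <- s | P i) dotp (F i) h.
Proof.
move=> LF Lh; elim: s => [|i s IH].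
  by under eq_fun do rewrite big_nil; rewrite big_nil dotp0l.
under eq_fun do rewrite big_cons.
rewrite big_cons; case: (P i) (LF i) => // /(_ isT) LFi.
by rewrite dotpDl ?IH //; exact: Lfun2_sum.
Qed.

Lemma dotp_ge0 f : 0 <= dotp f f.
Proof. by apply: Rintegral_ge0 => x _; rewrite -expr2 sqr_ge0. Qed.

Lemma dotp_sqrB f g : f \in Lfun mu 2%:E -> g \in Lfun mu 2%:E ->
  dotp (fun x => f x - g x) (fun x => f x - g x)
  = dotp f f - 2 * dotp f g + dotp g g.
Proof.
move=> Lf Lg; have Lfg := Lfun2_sub Lf Lg.
rewrite dotpBl // !dotpBr // (dotpC g f); lra.
Qed.

(** Minimising the nonnegative quadratic [|f - t g|^2] over [t] gives the bound when [g] has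
    positive norm. *)
Lemma CauchySchwarz f g : f \in Lfun mu 2%:E -> g \in Lfun mu 2%:E ->
  dotp f g ^+ 2 <= dotp f f * dotp g g.
Proof.
move=> Lf Lg.
have q t : 0 <= dotp f f - 2 * t * dotp f g + t ^+ 2 * dotp g g.
  have Lt : (fun x => t * g x) \in Lfun mu 2%:E by exact: Lfun2_scale.
  have := dotp_ge0 (fun x => f x - t * g x).
  by rewrite dotp_sqrB // dotpZr // dotpZl // dotpZr // mulrA expr2 mulrA.
have := dotp_ge0 g; rewrite le_eqVlt => /predU1P[g0|g0]; last first.
  have := q (dotp f g / dotp g g); set a := dotp f f; set b := dotp f g.
  rewrite -/b; have gn0 : dotp g g != 0 by rewrite gt_eqF.
  rewrite (_ : a - _ + _ = (a * dotp g g - b ^+ 2) / dotp g g); last by field.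
  by rewrite pmulr_lge0 ?invr_gt0 // subr_ge0.
rewrite -g0 mulr0 le_eqVlt; apply/orP; left; rewrite sqrf_eq0; apply/eqP.
apply/eqP/negP => /negP b0.
(* With [dotp g g = 0] the quadratic is affine in [t]; this [t] makes its value [-1]. *)
have := q ((dotp f f + 1) / (2 * dotp f g)); rewrite -g0 mulr0 addr0.
rewrite (_ : 2 * _ * _ = dotp f f + 1); last by field; rewrite b0.
by rewrite opprD addNKr; lra.
Qed.

Lemma dotp_ae f f' g : f \in Lfun mu 2%:E -> f' \in Lfun mu 2%:E ->
  g \in Lfun mu 2%:E -> f = f' %[ae mu] -> dotp f g = dotp f' g.
Proof.
move=> /measurable_Lfun mf /measurable_Lfun mf' /measurable_Lfun mg ff'.
congr fine; apply: ae_eq_integral => //.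
- by apply/measurable_EFinP; exact: measurable_funM.
- by apply/measurable_EFinP; exact: measurable_funM.
- by apply: filterS ff' => x fx _; rewrite fx.
Qed.

Lemma dotp_eq0 f : f \in Lfun mu 2%:E -> dotp f f = 0 -> f = (fun=> 0) %[ae mu].
Proof.
move=> Lf f0; have := integrable_mul Lf Lf.
have mf := measurable_Lfun Lf => If.
have f0' : (\int[mu]_x `|(f x * f x)%:E| = 0)%E.
  under eq_integral do rewrite gee0_abs ?lee_fin -?expr2 ?sqr_ge0 // expr2.
  rewrite -(fineK (integrable_fin_num measurableT If)).
  by move: f0; rewrite /dotp /Rintegral /= => ->.
move/ae_eq_integral_abs: f0' => /(_ measurableT).
case.
  by apply/measurable_EFinP; exact: measurable_funM.
move=> N [mN N0 sN]; exists N; split=> // x /= fx; apply: sN => /= H; apply: fx.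
move=> _; have := H I => -[] /eqP; rewrite mulf_eq0 orbb => /eqP; exact.
Qed.

Lemma ae_imply (P Q : T -> Prop) : {ae mu, forall x, P x} ->
  (forall x, P x -> Q x) -> {ae mu, forall x, Q x}.
Proof. by move=> aeP PQ; exact: filterS PQ aeP. Qed.

Lemma ae_and_imply (P1 P2 Q : T -> Prop) :
  {ae mu, forall x, P1 x} -> {ae mu, forall x, P2 x} ->
  (forall x, P1 x -> P2 x -> Q x) -> {ae mu, forall x, Q x}.
Proof. by move=> aeP1 aeP2 PQ; exact: filterS2 PQ aeP1 aeP2. Qed.

End SquareIntegrable.

(** * Powers that converge to a threshold function *)

Section Threshold.
Context (R : realType).

Lemma natmul_expr_le (t : R) n : 0 <= t <= 1 -> n%:R * (1 - t) * t ^+ n <= 1.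
Proof.
move=> /andP[t0 t1].
(* The left side is nonincreasing in [n]: one step loses [(n + 1) (1 - t)^2 t^n]. *)
have /(le_trans _) : (1 + n%:R * (1 - t)) * t ^+ n <= 1.
  elim: n => [|n IH]; first by rewrite expr0; lra.
  apply: le_trans IH; rewrite exprS -natr1 mulrA ler_wpM2r ?exprn_ge0 //.
  have n0 : (0 : R) <= n%:R by exact: ler0n.
  have := mulr_ge0 (addr_ge0 n0 (ler01)) (sqr_ge0 (1 - t)).
  nra.
by apply; rewrite ler_wpM2r ?exprn_ge0 //; lra.
Qed.

Lemma cvg_natmul_expr (r : R) : 0 <= r < 1 ->
  n%:R * r ^+ n @[n --> \oo] --> (0 : R).
Proof.
(* Since [r^n = t^n t^n], one factor absorbs [n] and the other still tends to 0. *)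
move=> /andP[r0 r1]; pose t := Num.sqrt r.
have t0 : 0 <= t by exact: sqrtr_ge0.
have t1 : t < 1 by rewrite -sqrtr1 ltr_sqrt.
have d0 : 0 < 1 - t by rewrite subr_gt0.
apply: (@squeeze_cvgr _ _ _ _ (fun=> 0) (fun n => (1 - t)^-1 * t ^+ n)).
- apply: nearW => n; rewrite mulr_ge0 ?exprn_ge0 //=.
  have -> : r ^+ n = t ^+ n * t ^+ n by rewrite -exprMn -expr2 sqr_sqrtr.
  rewrite mulrA ler_wpM2r ?exprn_ge0 // -div1r ler_pdivlMr // mulrAC.
  by apply: natmul_expr_le; rewrite t0 ltW.
- exact: cvg_cst.
- by apply: cvg_geometric; rewrite ger0_norm.
Qed.

Lemma onem_expr_ge (x : R) m : 0 <= x <= 1 -> 1 - m%:R * x <= (1 - x) ^+ m.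
Proof.
move=> /andP[x0 x1]; elim: m => [|m IH]; first by rewrite expr0; lra.
rewrite exprS; apply: (@le_trans _ _ ((1 - x) * (1 - m%:R * x))); last first.
  by rewrite ler_wpM2l // subr_ge0.
rewrite -natr1; have := mulr_ge0 (ler0n R m) (sqr_ge0 x); nra.
Qed.

(** The product [(1 - x)^m (1 + m x)] is nonincreasing in [m]. This yields the harmonic rate at the
    threshold. *)
Lemma onem_expr_le (x : R) m : 0 <= x <= 1 -> (1 - x) ^+ m <= (1 + m%:R * x)^-1.
Proof.
move=> /andP[x0 x1].
have m0 : 0 < 1 + m%:R * x by rewrite ltr_pwDl // mulr_ge0.
rewrite -div1r ler_pdivlMr //.
elim: m {m0} => [|m IH]; first by rewrite expr0; lra.
apply: le_trans IH; rewrite exprS -mulrA [leLHS]mulrCA ler_wpM2l //.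
  by rewrite exprn_ge0 // subr_ge0.
rewrite -natr1; have := mulr_ge0 (ler0n R m) (sqr_ge0 x).
by have := sqr_ge0 x; nra.
Qed.

(* The exponent [n * 2 ^ n] makes the limit vanish at [s = 2^-1] as well, where
   the exponent [2 ^ n] would give [expR (-1)]. *)
Lemma cvg_threshold (s : R) : 0 <= s <= 1 ->
  (1 - s ^+ n) ^+ (n * 2 ^ n) @[n --> \oo] --> (((s < 2^-1)%R)%:R : R).
Proof.
move=> /andP[s0 s1].
have sn n : 0 <= s ^+ n <= 1 by rewrite exprn_ge0 //= exprn_ile1.
have [s2|s2] := ltP s 2^-1 => /=.
  apply: (@squeeze_cvgr _ _ _ _ (fun n => 1 - n%:R * (2 * s) ^+ n) (fun=> 1)).
  - apply: nearW => n; rewrite exprMn -natrX mulrA -natrM onem_expr_ge //=.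
    by case/andP: (sn n) => a b; rewrite exprn_ile1 //; lra.
  - rewrite -[X in _ --> X]subr0; apply: cvgB; first exact: cvg_cst.
    by apply: cvg_natmul_expr; lra.
  - exact: cvg_cst.
apply: (@squeeze_cvgr _ _ _ _ (fun=> 0) (fun n => n.+1%:R^-1)).
- apply: nearW => n; case/andP: (sn n) => a b.
  rewrite exprn_ge0 ?subr_ge0 //=.
  have h2 : 0 <= (2^-1 : R) ^+ n <= 1.
    by rewrite exprn_ge0 //= exprn_ile1 // invf_le1 // ler1n.
  (* The power decreases in [s], so [s = 1/2] is the worst case, where the exponent times [2^-n] is
     [n] and the bound is [1 / (n + 1)]. *)
  apply: (@le_trans _ _ ((1 - 2^-1 ^+ n) ^+ (n * 2 ^ n))).
    by rewrite lerXn2r ?nnegrE ?subr_ge0 ?lerB ?lerXn2r ?nnegrE //; lra.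
  apply: le_trans (onem_expr_le _ h2) _.
  by rewrite natrM natrX exprVn mulfK ?expf_neq0 // -natr1 addrC.
- exact: cvg_cst.
- exact: cvg_harmonic.
Qed.

End Threshold.

(** * Closed subalgebras of L2 *)

Section L2Closure.
Context d (T : measurableType d) (R : realType).
Variable mu : {measure set T -> \bar R}.
Implicit Types (f g h t : T -> R) (A : set (T -> R)).

Definition sqnorm f : R := dotp mu f f.

Lemma sqnorm_ge0 f : 0 <= sqnorm f. Proof. exact: dotp_ge0. Qed.

(** The parallelogram law with [|f - g|^2] dropped; it serves as a triangle inequality without
    square roots. *)
Lemma sqnormD_le f g : f \in Lfun mu 2%:E -> g \in Lfun mu 2%:E ->
  sqnorm (fun x => f x + g x) <= 2 * sqnorm f + 2 * sqnorm g.
Proof.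
move=> Lf Lg; have := dotp_ge0 mu (fun x => f x - g x).
rewrite dotp_sqrB // /sqnorm dotpDl //; last exact: Lfun2_add.
rewrite !dotpDr // (dotpC mu g f); lra.
Qed.

Lemma sqnorm_dist_le f g h : f \in Lfun mu 2%:E -> g \in Lfun mu 2%:E ->
  h \in Lfun mu 2%:E ->
  sqnorm (fun x => f x - h x) <=
    2 * sqnorm (fun x => f x - g x) + 2 * sqnorm (fun x => g x - h x).
Proof.
move=> Lf Lg Lh; apply: le_trans (sqnormD_le _ _); [|exact: Lfun2_sub..].
rewrite le_eqVlt; apply/orP; left; apply/eqP; congr sqnorm.
by apply/funext => x; ring.
Qed.

Lemma sqnormZ a f : f \in Lfun mu 2%:E ->
  sqnorm (fun x => a * f x) = a ^+ 2 * sqnorm f.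
Proof.
move=> Lf; rewrite /sqnorm dotpZl ?dotpZr ?mulrA ?expr2 //.
exact: Lfun2_scale.
Qed.

Lemma sqnorm_bounded_mul f g (K : R) : measurable_fun setT f ->
  (forall x, `|f x| <= K) ->
  g \in Lfun mu 2%:E -> (fun x => f x * g x) \in Lfun mu 2%:E /\
  sqnorm (fun x => f x * g x) <= K ^+ 2 * sqnorm g.
Proof.
move=> mf fK Lg.
have mfg : measurable_fun setT (fun x => f x * g x).
  by apply: measurable_funM => //; exact: measurable_Lfun Lg.
have fgK x : `|f x * g x| <= K * `|g x| by rewrite normrM ler_wpM2r.
have Lfg : (fun x => f x * g x) \in Lfun mu 2%:E.
  apply: (@Lfun2_le _ _ _ _ _ (fun x => `|K * g x|)) => //.
    by move=> x; rewrite (le_trans (fgK x)) // normrM ler_wpM2r // ler_norm.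
  apply: (@Lfun2_le _ _ _ _ _ (fun x => `|K| * `|g x|)) => //.
  - apply: measurableT_comp => //; apply: measurable_funM => //.
    exact: measurable_Lfun Lg.
  - by move=> x; rewrite normr_id normrM.
  - apply: Lfun2_scale; apply/Lfun2P; split.
      by apply: measurableT_comp => //; exact: measurable_Lfun Lg.
    under eq_fun do rewrite real_normK ?num_real //.
    by case/Lfun2P : Lg.
split=> //; rewrite /sqnorm -[K ^+ 2 * _]mulrA.
have LKg : (fun x => K * g x) \in Lfun mu 2%:E by exact: Lfun2_scale.
rewrite -dotpZr // -dotpZl //.
apply: le_Rintegral => //; [exact: integrable_mul|exact: integrable_mul|].
move=> x _; rewrite -!expr2.
rewrite -[leLHS]real_normK ?num_real // -[leRHS]real_normK ?num_real //.
by rewrite lerXn2r ?nnegrE // (le_trans (fgK x)) // normrM ler_wpM2r // ler_norm.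
Qed.

Lemma sqnorm_dominated_cvg (f_ : nat -> T -> R) f h :
  (forall n, measurable_fun setT (f_ n)) -> measurable_fun setT f ->
  (forall x, f_ n x @[n --> \oo] --> f x) ->
  (forall n x, `|f x - f_ n x| <= h x) -> h \in Lfun mu 2%:E ->
  sqnorm (fun x => f x - f_ n x) @[n --> \oo] --> 0.
Proof.
move=> mf_ mf ff fh Lh.
have [mh Ih] := (Lfun2P mu h).1 Lh.
have [] := @dominated_convergence _ _ _ mu setT measurableT
  (fun n x => ((f x - f_ n x) * (f x - f_ n x))%:E) (cst 0%E)
  (EFin \o (fun x => h x ^+ 2)).
- move=> n; apply/measurable_EFinP.
  by apply: measurable_funM; exact: measurable_funB.
- exact: measurable_cst.
- apply: nearW => x _; apply/fine_cvgP; split; first exact: nearW.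
  rewrite -[X in _ --> X](mulr0 (0 : R)) -(subrr (f x)).
  by apply: cvgM; (apply: cvgB; [exact: cvg_cst|exact: ff]).
- exact: Ih.
- apply: nearW => x n _ /=; rewrite lee_fin -expr2 normrX.
  by rewrite lerXn2r ?nnegrE // (le_trans _ (fh n x)).
move=> _ _; rewrite integral0 => H.
exact: (fine_cvg H).
Qed.

Definition L2closure A f : Prop := f \in Lfun mu 2%:E /\
  forall e, 0 < e -> exists2 t, A t & sqnorm (fun x => f x - t x) < e.

(** The part that separation of points plays in the Stone-Weierstrass theorem is taken by the
    hypothesis of [L2closure_full] that all measurable sets are approximable. *)
Record bounded_algebra A : Prop := BoundedAlgebra {
  algebra_1 : A (fun=> 1);
  algebra_add : forall f g, A f -> A g -> A (fun x => f x + g x);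
  algebra_scale : forall a f, A f -> A (fun x => a * f x);
  algebra_mul : forall f g, A f -> A g -> A (fun x => f x * g x);
  algebra_bounded : forall f, A f -> exists K, forall x, `|f x| <= K;
  algebra_measurable : forall f, A f -> measurable_fun setT f }.

End L2Closure.

Section DenseAlgebra.
Context d (T : measurableType d) (R : realType).
Variable mu : {measure set T -> \bar R}.
Variable A : set (T -> R).
Hypothesis mufin : (mu setT < +oo)%E.
Hypothesis algA : bounded_algebra A.
Implicit Types (f g h t : T -> R) (B : set T).
Local Notation clA := (L2closure mu A).

Lemma Lfun2_cst (a : R) : (fun=> a) \in Lfun mu 2%:E.
Proof.
apply/Lfun2P; split=> //; apply/integrableP; split.
  exact/measurable_EFinP.
by rewrite integral_cst // lte_mul_pinfty.
Qed.

Lemma Lfun2_bounded f (K : R) : measurable_fun setT f -> (forall x, `|f x| <= K) ->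
  f \in Lfun mu 2%:E.
Proof. by move=> mf fK; exact: Lfun2_le (Lfun2_cst K). Qed.

Lemma algebra_Lfun2 t : A t -> t \in Lfun mu 2%:E.
Proof.
move=> At; have [K tK] := algebra_bounded algA At.
exact: Lfun2_bounded (algebra_measurable algA At) tK.
Qed.

Lemma L2closure_Lfun f : clA f -> f \in Lfun mu 2%:E. Proof. by case. Qed.

Lemma L2closure_algebra f : A f -> clA f.
Proof.
move=> Af; split; first exact: algebra_Lfun2.
move=> e e0; exists f => //; rewrite (_ : (fun x => _) = fun=> 0).
  by rewrite /sqnorm dotp0l.
by apply/funext => x; rewrite subrr.
Qed.

Lemma L2closure_closed f : f \in Lfun mu 2%:E ->
  (forall e, 0 < e -> exists2 g, clA g & sqnorm mu (fun x => f x - g x) < e) ->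
  clA f.
Proof.
move=> Lf H; split=> // e e0.
have e4 : 0 < e / 4 by rewrite divr_gt0.
have [g [Lg cg] fg] := H _ e4; have [t At gt] := cg _ e4.
exists t => //; apply: le_lt_trans (sqnorm_dist_le Lf Lg (algebra_Lfun2 At)) _.
lra.
Qed.

Lemma L2closure_dominated (f_ : nat -> T -> R) f h :
  (forall n, clA (f_ n)) -> measurable_fun setT f ->
  (forall x, f_ n x @[n --> \oo] --> f x) ->
  (forall n x, `|f x - f_ n x| <= h x) -> h \in Lfun mu 2%:E ->
  f \in Lfun mu 2%:E -> clA f.
Proof.
move=> cf mf ff fh Lh Lf; apply: L2closure_closed => // e e0.
have mf_ n : measurable_fun setT (f_ n).
  exact: measurable_Lfun (L2closure_Lfun (cf n)).
have /cvgrPdist_lt /(_ _ e0) [N _ /(_ N (leqnn N))] :=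
  sqnorm_dominated_cvg mf_ mf ff fh Lh.
by rewrite sub0r normrN ger0_norm ?sqnorm_ge0 //; exists (f_ N).
Qed.

Lemma L2closure_add f g : clA f -> clA g -> clA (fun x => f x + g x).
Proof.
move=> [Lf cf] [Lg cg]; split; first exact: Lfun2_add.
move=> e e0; have e4 : 0 < e / 4 by rewrite divr_gt0.
have [t At ft] := cf _ e4; have [s As gs] := cg _ e4.
exists (fun x => t x + s x); first exact: (algebra_add algA).
have Lt := algebra_Lfun2 At; have Ls := algebra_Lfun2 As.
have := sqnormD_le (Lfun2_sub Lf Lt) (Lfun2_sub Lg Ls).
rewrite (_ : (fun x => f x - t x + _) = fun x => f x + g x - (t x + s x)); last first.
  by apply/funext => x; ring.
by lra.
Qed.

Lemma L2closure_scale a f : clA f -> clA (fun x => a * f x).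
Proof.
move=> [Lf cf]; split; first exact: Lfun2_scale.
move=> e e0; have ea : 0 < e / (a ^+ 2 + 1).
  by rewrite divr_gt0 // ltr_wpDl ?sqr_ge0.
have [t At ft] := cf _ ea; have Lt := algebra_Lfun2 At.
exists (fun x => a * t x); first exact: (algebra_scale algA).
rewrite (_ : (fun x => _) = fun x => a * (f x - t x)); last first.
  by apply/funext => x; ring.
rewrite sqnormZ; last exact: Lfun2_sub.
move: ft; rewrite ltr_pdivlMr ?ltr_wpDl ?sqr_ge0 //; apply: le_lt_trans.
by rewrite mulrC ler_wpM2l ?sqnorm_ge0 // lerDl.
Qed.

Lemma L2closure_sum (I : Type) (s : seq I) (F : I -> T -> R) :
  (forall i, clA (F i)) -> clA (fun x => \sum_(i <- s) F i x).
Proof.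
move=> cF; elim: s => [|i s IH].
  under eq_fun do rewrite big_nil.
  have /(L2closure_scale 0) := L2closure_algebra (algebra_1 algA).
  by under eq_fun do rewrite mul0r.
by under eq_fun do rewrite big_cons; exact: L2closure_add.
Qed.

(** The product [f g] is compared with [f t], then with [s t]. The error in [s] gets multiplied by
    [t], so [t] and its bound [M] are fixed before [s] is chosen. *)
Lemma L2closure_bounded_mul f g (K : R) : clA f -> (forall x, `|f x| <= K) ->
  clA g -> clA (fun x => f x * g x).
Proof.
move=> [Lf cf] fK [Lg cg].
have mf := measurable_Lfun Lf.
have [Lfg _] := sqnorm_bounded_mul mf fK Lg.
apply: L2closure_closed => // e e0.
have eK : 0 < e / 4 / (K ^+ 2 + 1).
  by rewrite !divr_gt0 // ltr_wpDl ?sqr_ge0.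
have [t At gt] := cg _ eK; have Lt := algebra_Lfun2 At.
have [M tM] := algebra_bounded algA At.
have eM : 0 < e / 4 / (M ^+ 2 + 1).
  by rewrite !divr_gt0 // ltr_wpDl ?sqr_ge0.
have [s As fs] := cf _ eM; have Ls := algebra_Lfun2 As.
exists (fun x => s x * t x); first exact/L2closure_algebra/(algebra_mul algA).
have [L1 le1] := sqnorm_bounded_mul mf fK (Lfun2_sub Lg Lt).
have [L2 le2] := sqnorm_bounded_mul (measurable_Lfun Lt) tM (Lfun2_sub Lf Ls).
have := sqnormD_le L1 L2.
rewrite (_ : (fun x => f x * _ + _) = fun x => f x * g x - s x * t x); last first.
  by apply/funext => x; ring.
move=> /le_lt_trans; apply.
have h (a b : R) : a < e / 4 / (b ^+ 2 + 1) -> 0 <= a -> b ^+ 2 * a < e / 4.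
  rewrite ltr_pdivlMr ?ltr_wpDl ?sqr_ge0 // => ab a0; apply: le_lt_trans ab.
  by rewrite mulrC ler_wpM2l // lerDl.
have := h _ _ gt (sqnorm_ge0 _ _); have := h _ _ fs (sqnorm_ge0 _ _); lra.
Qed.

Lemma L2closure_ae f g : clA f -> g \in Lfun mu 2%:E -> f = g %[ae mu] -> clA g.
Proof.
move=> cf Lg fg; apply: L2closure_closed => // e e0; exists f => //.
have Lf := L2closure_Lfun cf; have Lgf := Lfun2_sub Lg Lf.
rewrite /sqnorm (_ : dotp _ _ _ = 0) //.
rewrite (dotp_ae Lgf (Lfun2_0 mu) Lgf) ?dotp0l //.
by apply: filterS fg => x /= -> //; rewrite subrr.
Qed.

End DenseAlgebra.

(** * Sets with approximable indicator function *)

Section DenseSets.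
Import HBNNSimple.
Context d (T : measurableType d) (R : realType).
Variable mu : {measure set T -> \bar R}.
Variable A : set (T -> R).
Hypothesis mufin : (mu setT < +oo)%E.
Hypothesis algA : bounded_algebra A.
Implicit Types (f g h t : T -> R) (B : set T).
Local Notation clA := (L2closure mu A).

Definition approx_set : set (set T) :=
  [set B | measurable B /\ clA (fun x => \1_B x)].

Lemma normr_indic_le1 B x : `|\1_B x : R| <= 1.
Proof. by rewrite indicE; case: (_ \in _); rewrite ?normr1 ?normr0. Qed.

Lemma Lfun2_indic B : measurable B -> (fun x => \1_B x : R) \in Lfun mu 2%:E.
Proof.
move=> mB; apply: (@Lfun2_bounded _ _ _ _ mufin _ 1); first exact: measurable_indic.
by move=> x; exact: normr_indic_le1.
Qed.

Lemma approx_set0 : approx_set set0.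
Proof.
split=> //; rewrite (_ : (fun x => _) = fun x => 0 * (fun=> 1) x).
  exact/(L2closure_scale mufin algA)/(L2closure_algebra mufin algA)/(algebra_1 algA).
by apply/funext => x; rewrite mul0r indic0.
Qed.

Lemma approx_setC B : approx_set B -> approx_set (~` B).
Proof.
move=> [mB cB]; split; first exact: measurableC.
rewrite (_ : (fun x => _) = fun x => (fun=> 1) x + -1 * \1_B x).
  apply: (L2closure_add mufin algA); last exact: (L2closure_scale mufin algA).
  exact/(L2closure_algebra mufin algA)/(algebra_1 algA).
apply/funext => x; rewrite !indicE in_setC; case: (x \in B) => /=; ring.
Qed.

Lemma approx_setI B C : approx_set B -> approx_set C -> approx_set (B `&` C).
Proof.
move=> [mB cB] [mC cC]; split; first exact: measurableI.
rewrite (_ : (fun x => _) = fun x => \1_B x * \1_C x).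
  apply: (L2closure_bounded_mul mufin algA (K := 1)) => //.
  exact: normr_indic_le1.
by apply/funext => x; rewrite !indicE in_setI;
  case: (x \in B); case: (x \in C); rewrite /= ?mulr1 ?mulr0.
Qed.

Lemma approx_set_cvg (B_ : nat -> set T) B : (forall n, approx_set (B_ n)) ->
  measurable B -> (forall x, \forall n \near \oo, (x \in B_ n) = (x \in B)) ->
  approx_set B.
Proof.
move=> cB mB BB; split=> //.
apply: (L2closure_dominated mufin algA (f_ := fun n x => \1_(B_ n) x)
  (h := fun=> 2)) => //.
- by move=> n; case: (cB n).
- exact: measurable_indic.
- move=> x; apply: cvg_near_cst; near=> n; rewrite !indicE; congr (_%:R).
  by congr nat_of_bool; near: n; exact: BB.
- move=> n x; apply: le_trans (ler_normB _ _) _.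
  by apply: lerD; exact: normr_indic_le1.
- exact: Lfun2_cst.
- exact: Lfun2_indic.
Unshelve. all: by end_near. Qed.

Lemma approx_set_sigma_algebra : sigma_algebra setT approx_set.
Proof.
split; [exact: approx_set0 | by move=> B /approx_setC; rewrite setTD |].
move=> F cF; apply: (@approx_set_cvg (fun n => \big[setU/set0]_(k < n) F k)).
- elim=> [|n IH]; first by rewrite big_ord0; exact: approx_set0.
  rewrite big_ord_recr /= -[_ `|` _]setCK setCU; apply: approx_setC.
  by apply: approx_setI; exact: approx_setC.
- by apply: bigcupT_measurable => k; case: (cF k).
- move=> x; have [|Fx] := boolP (x \in \bigcup_k F k).
    rewrite inE => -[k _ Fkx]; exists k.+1 => // n /= kn.
    by apply: mem_set; rewrite -bigcup_mkord; exists k.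
  apply: nearW => n; apply: negbTE; move: Fx; rewrite !notin_setE.
  by apply: contra_not; rewrite -bigcup_mkord => -[k _ Fk]; exists k.
Qed.

Lemma algebra_exp f n : A f -> A (fun x => f x ^+ n).
Proof.
move=> Af; elim: n => [|n IH]; first exact: algebra_1.
by under eq_fun do rewrite exprS; exact: algebra_mul.
Qed.

(* After rescaling [f] into [0, 1], polynomials in [f] converge boundedly to the
   indicator function, by [cvg_threshold]. *)
Lemma approx_superlevel f (c : R) : A f -> approx_set [set x | c < f x].
Proof.
move=> Af; have [K fK] := algebra_bounded algA Af.
(* This [D] forces [|f - c| / D <= 1/2], so [s] takes values in [0, 1]; the minus sign makes [c < f]
   correspond to [s < 1/2]. *)
pose D := 2 * (`|K| + `|c| + 1); have D0 : 0 < D.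
  by rewrite /D mulr_gt0 // ltr_wpDl // addr_ge0.
pose s x := 2^-1 + c / D + - D^-1 * f x.
have As : A s.
  rewrite /s; apply: (algebra_add algA); last exact: (algebra_scale algA).
  have := algebra_scale algA (2^-1 + c / D) (algebra_1 algA).
  by under eq_fun do rewrite mulr1.
have sE x : s x = 2^-1 - (f x - c) / D by rewrite /s; ring.
have s01 x : 0 <= s x <= 1.
  have : `|(f x - c) / D| <= 2^-1.
    rewrite normrM normfV (gtr0_norm D0) ler_pdivrMr // /D mulrA mulVf // mul1r.
    have := ler_normB (f x) c; have := fK x; have := ler_norm K; lra.
  by rewrite ler_norml => /andP[h1 h2]; rewrite (sE x); apply/andP; split; lra.
have sc x : (s x < 2^-1) = (c < f x).
  by rewrite sE gtrDl oppr_lt0 pmulr_lgt0 ?invr_gt0 // subr_gt0.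
have mc : measurable [set x | c < f x].
  rewrite (_ : [set x | _] = setT `&` f @^-1` `]c, +oo[%classic).
    by apply: (algebra_measurable algA Af).
  by apply/seteqP; split=> x /=; rewrite in_itv /= andbT => // -[].
split=> //.
apply: (L2closure_dominated mufin algA
  (f_ := fun n x => (1 - s x ^+ n) ^+ (n * 2 ^ n)) (h := fun=> 2)) => //.
- move=> n; apply: (L2closure_algebra mufin algA); apply: algebra_exp.
  apply: (algebra_add algA); first exact: (algebra_1 algA).
  have := algebra_scale algA (-1) (algebra_exp n As).
  by under eq_fun do rewrite mulN1r.
- exact: measurable_indic.
- move=> x; rewrite indicE.
  have -> : (x \in [set y | c < f y]) = (s x < 2^-1).
    by rewrite sc; apply/idP/idP => [/set_mem|cf]; last exact: mem_set.
  exact: cvg_threshold.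
- move=> n x; apply: le_trans (ler_normB _ _) _.
  apply: lerD; first exact: normr_indic_le1.
  have /andP[s0 s1] := s01 x.
  have h0 : 0 <= s x ^+ n by rewrite exprn_ge0.
  have h1 : s x ^+ n <= 1 by rewrite exprn_ile1.
  rewrite ger0_norm ?exprn_ge0 ?subr_ge0 //.
  by rewrite exprn_ile1 ?subr_ge0 // gerBl.
- exact: Lfun2_cst.
- exact: Lfun2_indic.
Qed.

(** A nonnegative [f] is a dominated limit of simple functions, which are combinations of
    approximable indicators; the signed case follows from positive and negative parts. *)
Lemma L2closure_full : measurable `<=` approx_set ->
  forall f, f \in Lfun mu 2%:E -> clA f.
Proof.
move=> mA; have pos f : (forall x, 0 <= f x) -> f \in Lfun mu 2%:E -> clA f.
  move=> f0 Lf; have mf := measurable_Lfun Lf.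
  have mEf : measurable_fun setT (EFin \o f) by exact/measurable_EFinP.
  have f0' x : setT x -> (0 <= (EFin \o f) x)%E by rewrite lee_fin.
  pose g := nnsfun_approx measurableT mEf.
  have gf x : g n x @[n --> \oo] --> f x.
    exact: (fine_cvg (cvg_nnsfun_approx measurableT mEf f0' (x := x) I)).
  have gle n x : g n x <= f x.
    have ndx : nondecreasing_seq (fun n => g n x).
      by move=> m k mk; have /lefP := nd_nnsfun_approx measurableT mEf mk.
    have := nondecreasing_cvgn_le ndx (cvgP _ (gf x)) n.
    by rewrite (cvg_lim _ (gf x)).
  apply: (L2closure_dominated mufin algA (f_ := fun n x => g n x) (h := f)) => //.
    move=> n; under eq_fun do rewrite fimfunEord.
    apply: (L2closure_sum mufin algA) => i; apply: (L2closure_scale mufin algA).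
    by apply: (mA _ _).2; exact: measurable_funPTI.
  move=> n x; have g0 : 0 <= g n x by exact: fun_ge0.
  by rewrite ger0_norm ?subr_ge0 // gerBl.
move=> f Lf; have mf := measurable_Lfun Lf.
pose p x := Num.max (f x) 0; pose q x := Num.max (- f x) 0.
have fpq x : f x = p x + -1 * q x.
  by rewrite /p /q /Num.max; case: ltP => h1; case: ltP => h2; lra.
have pf x : `|p x| <= `|f x|.
  by rewrite /p /Num.max; case: ltP => //; rewrite normr0.
have qf x : `|q x| <= `|f x|.
  by rewrite /q /Num.max; case: ltP => //; rewrite ?normr0 ?normrN.
have Lnf : (fun x => `|f x|) \in Lfun mu 2%:E.
  apply/Lfun2P; split; first exact: measurableT_comp.
  under eq_fun do rewrite real_normK ?num_real //.
  by case/Lfun2P : Lf.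
rewrite (_ : f = fun x => p x + -1 * q x); last exact/funext.
apply: (L2closure_add mufin algA); last apply: (L2closure_scale mufin algA).
- apply: pos; first by move=> x; rewrite le_max lexx orbT.
  by apply: Lfun2_le pf Lnf; exact: measurable_maxr.
- apply: pos; first by move=> x; rewrite le_max lexx orbT.
  apply: Lfun2_le qf Lnf; apply: measurable_maxr => //.
  exact: measurableT_comp.
Qed.

End DenseSets.

(** * Trigonometric polynomials on the torus *)

Section TrigAlgebra.
Variable R : realType.
Local Notation mu := (torus R).
Implicit Types (a b : int) (x : R * R).

Definition lin a b x : R := a%:~R * x.1 + b%:~R * x.2.

(** Products are not a constructor: [trig_mul] recovers them from the product-to-sum formulas, so
    inductions over derivatives and degrees need only the linear cases. *)
Inductive trig : sfield R -> Prop :=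
| trig_cos a b : trig (fun x => cos (lin a b x))
| trig_sin a b : trig (fun x => sin (lin a b x))
| trig_add f g : trig f -> trig g -> trig (fun x => f x + g x)
| trig_scale (c : R) f : trig f -> trig (fun x => c * f x).

Lemma trig_ext f g : trig f -> f =1 g -> trig g.
Proof. by move=> tf /funext <-. Qed.

Lemma lin0 x : lin 0 0 x = 0. Proof. by rewrite /lin !mul0r addr0. Qed.

Lemma linD a b a' b' x : lin (a + a') (b + b') x = lin a b x + lin a' b' x.
Proof. by rewrite /lin !intrD; ring. Qed.

Lemma linN a b x : lin (- a) (- b) x = - lin a b x.
Proof. by rewrite /lin !intrN; ring. Qed.

Lemma linB a b a' b' x : lin (a - a') (b - b') x = lin a b x - lin a' b' x.
Proof. by rewrite linD linN. Qed.

Lemma trig1 : trig (fun=> 1).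
Proof. by apply: trig_ext (trig_cos 0 0) _ => x; rewrite lin0 cos0. Qed.

Lemma trig_mul f g : trig f -> trig g -> trig (fun x => f x * g x).
Proof.
move=> tf tg; elim: tf g tg => {f}
    [a b|a b|f f' _ IH _ IH'|c f _ IH] g tg; last 2 first.
- by apply: trig_ext (trig_add (IH _ tg) (IH' _ tg)) _ => x; ring.
- by apply: trig_ext (trig_scale c (IH _ tg)) _ => x; ring.
- elim: tg => {g} [a' b'|a' b'|g g' _ IH _ IH'|c g _ IH].
  + apply: trig_ext (trig_scale 2^-1
      (trig_add (trig_cos (a - a') (b - b')) (trig_cos (a + a') (b + b')))) _.
    by move=> x; rewrite linB linD cosB cosD; field.
  + apply: trig_ext (trig_scale 2^-1
      (trig_add (trig_sin (a + a') (b + b')) (trig_sin (a' - a) (b' - b)))) _.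
    by move=> x; rewrite linB linD sinB sinD; field.
  + by apply: trig_ext (trig_add IH IH') _ => x; ring.
  + by apply: trig_ext (trig_scale c IH) _ => x; ring.
- elim: tg => {g} [a' b'|a' b'|g g' _ IH _ IH'|c g _ IH].
  + apply: trig_ext (trig_scale 2^-1
      (trig_add (trig_sin (a + a') (b + b')) (trig_sin (a - a') (b - b')))) _.
    by move=> x; rewrite linB linD sinB sinD; field.
  + apply: trig_ext (trig_scale 2^-1
      (trig_add (trig_cos (a - a') (b - b'))
         (trig_scale (-1) (trig_cos (a + a') (b + b'))))) _.
    by move=> x; rewrite linB linD cosB cosD; field.
  + by apply: trig_ext (trig_add IH IH') _ => x; ring.
  + by apply: trig_ext (trig_scale c IH) _ => x; ring.
Qed.

Lemma measurable_lin a b :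
  measurable_fun setT (lin a b : measurableTypeR R * measurableTypeR R -> R).
Proof. by apply: measurable_funD; apply: measurable_funM. Qed.

Lemma measurable_cos_lin a b : measurable_fun setT
  ((fun x => cos (lin a b x)) : measurableTypeR R * measurableTypeR R -> R).
Proof.
apply: (@measurableT_comp _ _ _ _ _ _ cos); last exact: measurable_lin.
by apply: continuous_measurable_fun; exact: continuous_cos.
Qed.

Lemma measurable_sin_lin a b : measurable_fun setT
  ((fun x => sin (lin a b x)) : measurableTypeR R * measurableTypeR R -> R).
Proof.
apply: (@measurableT_comp _ _ _ _ _ _ sin); last exact: measurable_lin.
by apply: continuous_measurable_fun; exact: continuous_sin.
Qed.

Lemma trig_algebra : bounded_algebra
  (trig : set (measurableTypeR R * measurableTypeR R -> R)).
Proof.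
split; [exact: trig1|exact: trig_add|exact: trig_scale|exact: trig_mul| |].
- move=> f; elim=> {f} [a b|a b|f g _ [K fK] _ [M gM]|c f _ [K fK]].
  + by exists 1 => x; exact: cos_max.
  + by exists 1 => x; exact: sin_max.
  + by exists (K + M) => x; rewrite (le_trans (ler_normD _ _)) // lerD.
  + by exists (`|c| * K) => x; rewrite normrM ler_wpM2l.
- move=> f; elim=> {f} [a b|a b|f g _ mf _ mg|c f _ mf].
  + exact: measurable_cos_lin.
  + exact: measurable_sin_lin.
  + exact: measurable_funD.
  + exact: measurable_funM.
Qed.

Lemma twopi_gt0 : 0 < 2 * pi :> R. Proof. by rewrite mulr_gt0 // pi_gt0. Qed.

Lemma lebesgue_sideT :
  lebesgue_side R (setT : set (measurableTypeR R)) = (2 * pi)%:E.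
Proof.
rewrite /lebesgue_side /= /mfrestr /mrestr setTI.
by rewrite lebesgue_measure_itv /= lte_fin twopi_gt0 oppr0 adde0.
Qed.

Lemma torusX (A B : set (measurableTypeR R)) : measurable A -> measurable B ->
  mu (A `*` B) = (lebesgue_side R A * lebesgue_side R B)%E.
Proof. exact: product_measure1E. Qed.

Lemma torusT : mu setT = ((2 * pi) ^+ 2)%:E.
Proof.
rewrite -setXTT torusX // expr2 EFinM.
by congr (_ * _)%E; exact: lebesgue_sideT.
Qed.

Lemma torus_fin : (mu setT < +oo)%E.
Proof. by rewrite torusT ltry. Qed.

Lemma torus_ae_fst (P : set R) : measurable (P : set (measurableTypeR R)) ->
  lebesgue_side R P = 0%E -> {ae mu, forall x, ~ P x.1}.
Proof.
move=> mP P0; exists (P `*` setT); split.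
- exact: measurableX.
- by rewrite torusX // P0 mul0e.
- by move=> x /= /contrapT.
Qed.

Lemma torus_ae_snd (P : set R) : measurable (P : set (measurableTypeR R)) ->
  lebesgue_side R P = 0%E -> {ae mu, forall x, ~ P x.2}.
Proof.
move=> mP P0; exists (setT `*` P); split.
- exact: measurableX.
- by rewrite torusX // P0 mule0.
- by move=> x /= /contrapT.
Qed.

Lemma lebesgue_side_setC_oo :
  lebesgue_side R (~` `]0, 2 * pi[%classic) = 0%E.
Proof.
rewrite /lebesgue_side /= /mfrestr /mrestr.
apply: countable_lebesgue_measure0; apply: finite_set_countable.
apply: (@sub_finite_set _ _ [set 0; 2 * pi]); last exact: finite_set2.
move=> x [] /=; rewrite /side /= !in_itv /= => /negP.
rewrite negb_and -!leNgt => /orP[x0|x0] /andP[x1 x2]; [left|right].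
  by apply/eqP; rewrite eq_le x0.
by apply/eqP; rewrite eq_le x0 x2.
Qed.

(** The edges are null. They have to be discarded because periodic functions agree at 0 and
    [2 * pi], so no superlevel set separates these points. *)
Lemma torus_ae_oo :
  {ae mu, forall x, [/\ 0 < x.1, x.1 < 2 * pi, 0 < x.2 & x.2 < 2 * pi]}.
Proof.
have mC : measurable (~` `]0, 2 * pi[%classic : set (measurableTypeR R)).
  exact: measurableC.
have h1 := torus_ae_fst mC lebesgue_side_setC_oo.
have h2 := torus_ae_snd mC lebesgue_side_setC_oo.
refine (ae_and_imply h1 h2 _).
by move=> x /contrapT /= + /contrapT /=; rewrite !in_itv /= => /andP[? ?] /andP[].
Qed.

Local Notation cset := (approx_set mu trig).

Lemma approx_set_ae (B C : set (measurableTypeR R * measurableTypeR R)) :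
  cset B -> measurable C -> {ae mu, forall x, B x <-> C x} -> cset C.
Proof.
move=> [mB cB] mC BC; split=> //.
apply: (L2closure_ae torus_fin trig_algebra cB).
  exact: Lfun2_indic torus_fin _ mC.
refine (ae_imply BC _) => x BCx /=; rewrite !indicE.
suff -> : (x \in B) = (x \in C) by [].
by apply/idP/idP => /set_mem /BCx /mem_set.
Qed.

Lemma sin_sign (s : R) : - pi < s < pi -> (0 < sin s) = (0 < s).
Proof.
move=> /andP[s1 s2]; have [s0|s0|<-] := ltgtP 0 s.
- by rewrite sin_gt0_pi // s0.
- apply/negbTE; rewrite -leNgt -[s]opprK sinN oppr_le0 sin_ge0_pi //.
  by rewrite oppr_ge0 ltW //= lerNl ltW.
- by rewrite sin0 ltxx.
Qed.

(* Half-lines are superlevel sets of trigonometric polynomials inside a period. *)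
Lemma cos_gt_half (a t : R) : 0 < a < 2 * pi -> 0 < t < 2 * pi ->
  (cos (a / 2) < cos (t - a / 2)) = (t < a).
Proof.
move=> /andP[a0 a2] /andP[t0 t2].
(* Sum to product: [cos (t - a/2) - cos (a/2) = 2 sin (t/2) sin ((a - t)/2)], and [sin (t/2)] is
   positive inside the period. *)
have -> : t - a / 2 = t / 2 - (a - t) / 2 by lra.
have -> : a / 2 = t / 2 + (a - t) / 2 by lra.
rewrite cosD cosB -subr_gt0.
have -> : (cos (t / 2) * cos ((a - t) / 2) + sin (t / 2) * sin ((a - t) / 2)) -
  (cos (t / 2) * cos ((a - t) / 2) - sin (t / 2) * sin ((a - t) / 2)) =
  (2 * sin (t / 2)) * sin ((a - t) / 2) by ring.
rewrite pmulr_rgt0; last by rewrite mulr_gt0 // sin_gt0_pi //; apply/andP; split; lra.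
rewrite sin_sign; last by apply/andP; split; lra.
by apply/idP/idP; lra.
Qed.

(** For [0 < a < 2 * pi] this is a superlevel set of a cosine; for any other [a] the half-space is
    null or of full measure. *)
Lemma approx_set_halfspace (a : R)
    (p : measurableTypeR R * measurableTypeR R -> measurableTypeR R) :
  measurable_fun setT p ->
  {ae mu, forall x, 0 < p x < 2 * pi} ->
  trig (fun x => cos (p x - a / 2)) ->
  cset (p @^-1` `]-oo, a[%classic).
Proof.
move=> mp p2 tp.
have mpa : measurable (p @^-1` `]-oo, a[%classic).
  by rewrite -[X in measurable X]setTI; exact: mp.
have [a0|a0] := leP a 0.
  refine (approx_set_ae (approx_set0 torus_fin trig_algebra) mpa _).
  refine (ae_imply p2 _) => x /andP[px _]; split=> //=.
  by rewrite in_itv /=; move=> ?; lra.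
have [a2|a2] := leP (2 * pi) a.
  refine (approx_set_ae (approx_setC torus_fin trig_algebra
    (approx_set0 torus_fin trig_algebra)) mpa _).
  refine (ae_imply p2 _) => x /andP[_ px]; rewrite setC0; split=> //= _.
  by rewrite in_itv /=; lra.
have cs := approx_superlevel torus_fin trig_algebra (cos (a / 2)) tp.
refine (approx_set_ae cs mpa _).
refine (ae_imply p2 _) => x px /=.
by rewrite in_itv /= cos_gt_half // a0.
Qed.

(** The sets with approximable preimage form a sigma-algebra, and open left rays generate the Borel
    sets. *)
Lemma approx_set_preimage
    (p : measurableTypeR R * measurableTypeR R -> measurableTypeR R) :
  measurable_fun setT p ->
  {ae mu, forall x, 0 < p x < 2 * pi} ->
  (forall a : R, trig (fun x => cos (p x - a / 2))) ->
  forall B, measurable B -> cset (p @^-1` B).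
Proof.
move=> mp p2 tp B mB.
have [s0 sC sU] := approx_set_sigma_algebra torus_fin trig_algebra.
suff : (<<s [set A | exists x : R, A = `]-oo, x[%classic] >> : set (set R))
    `<=` [set B | cset (p @^-1` B)].
  have mB' : (@ocitv R).-sigma.-measurable B := mB.
  by apply; rewrite RGenInftyO.measurableE in mB'.
apply: smallest_sub.
- split=> /=.
  + by rewrite preimage_set0.
  + by move=> C cC; rewrite setTD preimage_setC -setTD; exact: sC.
  + by move=> F cF; rewrite preimage_bigcup; exact: sU.
- by move=> _ [a ->]; exact: approx_set_halfspace.
Qed.

Lemma trig_cos_fst (c : R) : trig (fun x => cos (x.1 - c)).
Proof.
apply: trig_ext (trig_add (trig_scale (cos c) (trig_cos 1 0))
  (trig_scale (sin c) (trig_sin 1 0))) _ => x.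
by rewrite /lin mul1r mul0r addr0 cosB; ring.
Qed.

Lemma trig_cos_snd (c : R) : trig (fun x => cos (x.2 - c)).
Proof.
apply: trig_ext (trig_add (trig_scale (cos c) (trig_cos 0 1))
  (trig_scale (sin c) (trig_sin 0 1))) _ => x.
by rewrite /lin mul1r mul0r add0r cosB; ring.
Qed.

(** The product sigma-algebra is generated by preimages under the two coordinate projections. *)
Lemma trig_dense f : f \in Lfun mu 2%:E -> L2closure mu trig f.
Proof.
apply: (L2closure_full torus_fin trig_algebra).
apply: smallest_sub; first exact: approx_set_sigma_algebra torus_fin trig_algebra.
rewrite subUset; split=> _ [B mB <-]; rewrite setTI.
- apply: approx_set_preimage => //.
    by refine (ae_imply torus_ae_oo _) => x [-> ->].
  by move=> a; exact: trig_cos_fst.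
- apply: approx_set_preimage => //.
    by refine (ae_imply torus_ae_oo _) => x [_ _ -> ->].
  by move=> a; exact: trig_cos_snd.
Qed.

End TrigAlgebra.

(** * Integrals of trigonometric functions over the torus *)

Section TrigIntegrals.
Variable R : realType.
Local Notation mu := (torus R).

Lemma cosD2pi_int (a : int) (c : R) : cos (a%:~R * (2 * pi) + c) = cos c.
Proof.
have h n (y : R) : cos (n%:R * (2 * pi) + y) = cos y.
  rewrite addrC (_ : n%:R * _ = pi *+ 2 *+ n); last first.
    by rewrite -[RHS]mulr_natl -(mulr_natl pi).
  exact/periodicn/cosD2pi.
case: a => n; first by rewrite -pmulrn.
by rewrite -cosN NegzE intrN opprD mulNr opprK h cosN.
Qed.

(** Passes from a measure on the whole line to an integral over an interval, the form in which the
    fundamental theorem of calculus applies. *)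
Lemma integral_side (f : R -> R) : (lebesgue_side R).-integrable setT (EFin \o f) ->
  (\int[lebesgue_side R]_x (f x)%:E =
   \int[lebesgue_measure]_(x in `[0%R, (2 * pi)%R]) (f x)%:E)%E.
Proof.
move=> If; pose S : set (measurableTypeR R) := @side R.
have mS : measurable S by exact: measurable_side.
have N0 : lebesgue_side R (~` S) = 0%E.
  by rewrite /lebesgue_side /= /mfrestr /mrestr setICl measure0.
rewrite (negligible_integral (N := ~` S)) //; last exact: measurableC.
rewrite setTD setCK; apply: eq_measure_integral => A mA AS.
by rewrite /lebesgue_side /= /mfrestr /mrestr setIidl.
Qed.

Lemma integral_side_cos (a : int) (c : R) : a != 0 ->
  (\int[lebesgue_side R]_x (cos (a%:~R * x + c))%:E = 0)%E.
Proof.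
move=> a0; have ar0 : a%:~R != 0 :> R by rewrite intr_eq0.
have dcos (x : R) : is_derive x 1 (fun x => a%:~R^-1 * sin (a%:~R * x + c))
    (cos (a%:~R * x + c)).
  apply: is_derive_eq.
  by rewrite /GRing.scale /=; field.
have mcos : measurable_fun setT
    ((fun x => cos (a%:~R * x + c)) : measurableTypeR R -> R).
  apply: (@measurableT_comp _ _ _ _ _ _ cos).
    by apply: continuous_measurable_fun; exact: continuous_cos.
  by apply: measurable_funD => //; exact: measurable_funM.
have sfin : (lebesgue_side R (setT : set (measurableTypeR R)) < +oo)%E.
  by rewrite lebesgue_sideT ltry.
rewrite integral_side; last first.
  apply: (@measurable_bounded_integrable _ _ _ _ _ _).
  - exact: measurableT.
  - exact: sfin.
  - exact: mcos.
  - exists 1; split=> // M M1 x _ /=; exact: le_trans (cos_max _) (ltW M1).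
rewrite (@continuous_FTC2 _ _ (fun x => a%:~R^-1 * sin (a%:~R * x + c))).
(* The sine becomes a cosine shifted by a quarter period, so that [cosD2pi_int] removes the multiple
   of [2 * pi] and the endpoint values cancel. *)
- rewrite -(cosBpihalf (_ * (2 * pi) + c)) -addrA cosD2pi_int cosBpihalf.
  by rewrite mulr0 add0r subee.
- exact: twopi_gt0.
- apply: continuous_subspaceT => x.
  apply: continuous_comp; last exact: continuous_cos.
  by apply: cvgD; [apply: cvgM; [exact: cvg_cst|exact: cvg_id]|exact: cvg_cst].
- have cF : continuous (fun x : R => a%:~R^-1 * sin (a%:~R * x + c)).
    move=> x; apply/differentiable_continuous/derivable1_diffP.
    exact: ex_derive.
  split.
  + by move=> x _; exact: ex_derive.
  + exact/cvg_at_right_filter/cF.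
  + exact/cvg_at_left_filter/cF.
- by move=> x _; rewrite derive1E derive_val.
Qed.

(** The shift [c] covers sines as well, with [c = - (pi / 2)]. By Fubini, a variable with nonzero
    frequency is integrated first, over a full period. *)
Lemma integ_cos (a b : int) (c : R) : integ (fun x => cos (lin a b x + c)) =
  if (a == 0) && (b == 0) then (2 * pi) ^+ 2 * cos c else 0.
Proof.
have Icos : mu.-integrable setT (EFin \o (fun x => cos (lin a b x + c))).
  apply: (@measurable_bounded_integrable _ _ _ _ _ _).
  - exact: measurableT.
  - exact: torus_fin.
  - apply: (@measurableT_comp _ _ _ _ _ _ cos).
      by apply: continuous_measurable_fun; exact: continuous_cos.
    by apply: measurable_funD => //; exact: measurable_lin.
  - exists 1; split=> // M M1 x _ /=; exact: le_trans (cos_max _) (ltW M1).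
have [a0|a0] := eqVneq a 0; have [b0|b0] := eqVneq b 0 => /=.
- rewrite /integ (_ : (fun x => _) = fun=> cos c).
    by rewrite Rintegral_cst // torusT mulrC.
  by apply/funext => x; rewrite a0 b0 lin0 add0r.
- suff I0 : (\int[mu]_x (cos (lin a b x + c))%:E = 0)%E
    by rewrite /integ /Rintegral I0.
  apply: etrans (esym (integral12_prod_meas1 Icos)) _.
  rewrite (eq_integral (cst 0%E)) ?integral0 // => x _ /=.
  rewrite /fubini_F /= /lin /=.
  under eq_integral do rewrite addrAC addrC.
  exact: integral_side_cos.
- suff I0 : (\int[mu]_x (cos (lin a b x + c))%:E = 0)%E
    by rewrite /integ /Rintegral I0.
  apply: etrans (esym (integral21_prod_meas1 Icos)) _.
  rewrite (eq_integral (cst 0%E)) ?integral0 // => y _ /=.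
  rewrite /fubini_G /= /lin /=.
  under eq_integral do rewrite -addrA.
  exact: integral_side_cos.
- suff I0 : (\int[mu]_x (cos (lin a b x + c))%:E = 0)%E
    by rewrite /integ /Rintegral I0.
  apply: etrans (esym (integral12_prod_meas1 Icos)) _.
  rewrite (eq_integral (cst 0%E)) ?integral0 // => x _ /=.
  rewrite /fubini_F /= /lin /=.
  under eq_integral do rewrite addrAC addrC.
  exact: integral_side_cos.
Qed.

End TrigIntegrals.

(** * Fourier sums *)

Section FourierSums.
Variable R : realType.
Local Notation mu := (torus R).
Local Notation waves N := ('I_N.*2.+1 * 'I_N.*2.+1)%type.

Definition freq N (i : 'I_N.*2.+1) : int := (i : nat)%:Z - N%:Z.

(** The index of [-k]: reversing an index in [0, .., 2N] negates its offset from [N]. *)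
Definition opp_wave N (k : waves N) : waves N := (rev_ord k.1, rev_ord k.2).

Definition lowfreq N (k : waves N) : bool :=
  \sum_j (wave R k j) ^+ 2 <= N%:R ^+ 2.

Definition cosk N (k : waves N) : sfield R := fun x => cos (phase k x).
Definition sink N (k : waves N) : sfield R := fun x => sin (phase k x).

(** One component of [PN]. As [k] and [-k] both occur, the coefficient is half of that in a real
    Fourier series. *)
Definition fsum N (g : sfield R) : sfield R := fun x =>
  \sum_(k : waves N | lowfreq k)
    ((2 * pi) ^- 2 * dotp mu g (cosk k) * cosk k x +
     (2 * pi) ^- 2 * dotp mu g (sink k) * sink k x).

Lemma PN_fsum N (u : vfield R) i : PN N u i = fsum N (u i).
Proof. by []. Qed.

Lemma waveE N (k : waves N) j :
  wave R k j = (if j == ord0 then freq k.1 else freq k.2)%:~R :> R.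
Proof. by rewrite /wave /freq; case: ifP => _; rewrite intrB. Qed.

Lemma phaseE N (k : waves N) : phase k = lin (freq k.1) (freq k.2) :> (R * R -> R).
Proof.
by apply/funext => x; rewrite /phase big_ord_recl big_ord1 !waveE /= /coord.
Qed.

Lemma freq_rev N (i : 'I_N.*2.+1) : freq (rev_ord i) = - freq i.
Proof.
rewrite /freq; have iN : (i <= N.*2)%N by rewrite -ltnS.
have -> : rev_ord i = (N.*2 - i)%N :> nat by rewrite /= subSS.
by rewrite -subzn //; move: (nat_of_ord i) => j; rewrite -addnn PoszD; ring.
Qed.

Lemma freq_eq N (i j : 'I_N.*2.+1) : (freq i == freq j) = (i == j).
Proof. by rewrite /freq (inj_eq (addIr _)) eqz_nat. Qed.

Lemma freq_inord (N : nat) (a : int) : (absz a <= N)%N ->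
  freq (inord (absz (a + N%:Z)) : 'I_N.*2.+1) = a.
Proof.
move=> aN; have a0 : 0 <= a + N%:Z.
  by rewrite -lerBlDr sub0r lerNl; apply: le_trans (lez_abs _) _; rewrite abszN.
have aN' : a <= N%:Z by apply: le_trans (lez_abs _) _.
rewrite /freq inordK; first by rewrite gez0_abs // addrK.
by rewrite ltnS -lez_nat gez0_abs // -addnn PoszD lerD2r.
Qed.

Lemma phase_opp N (k : waves N) x : phase (opp_wave k) x = - phase k x :> R.
Proof. by rewrite !phaseE /= !freq_rev linN. Qed.

Lemma lowfreqE N (k : waves N) :
  lowfreq k = ((freq k.1)%:~R ^+ 2 + (freq k.2)%:~R ^+ 2 <= N%:R ^+ 2 :> R).
Proof. by rewrite /lowfreq big_ord_recl big_ord1 !waveE. Qed.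

Lemma lowfreq_opp N (k : waves N) : lowfreq (opp_wave k) = lowfreq k.
Proof. by rewrite !lowfreqE /= !freq_rev !intrN !sqrrN. Qed.

Lemma trig_Lfun2 (t : sfield R) : trig t -> t \in Lfun mu 2%:E.
Proof. by move=> tt; exact: (algebra_Lfun2 (@torus_fin R) (@trig_algebra R) tt). Qed.

Lemma Lfun2_cosk N (k : waves N) : cosk k \in Lfun mu 2%:E.
Proof. by rewrite /cosk phaseE; apply: trig_Lfun2; exact: trig_cos. Qed.

Lemma Lfun2_sink N (k : waves N) : sink k \in Lfun mu 2%:E.
Proof. by rewrite /sink phaseE; apply: trig_Lfun2; exact: trig_sin. Qed.

#[local] Hint Resolve Lfun2_cosk Lfun2_sink : core.

Lemma integ_cos_lin (a b : int) : integ (fun x => cos (lin a b x)) =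
  (2 * pi) ^+ 2 * ((a == 0) && (b == 0))%:R :> R.
Proof.
have := @integ_cos R a b 0; under eq_fun do rewrite addr0.
by move=> ->; case: ifP; rewrite ?cos0 ?mulr1 ?mulr0.
Qed.

Lemma integ_sin_lin (a b : int) : integ (fun x => sin (lin a b x)) = 0 :> R.
Proof.
have := @integ_cos R a b (- (pi / 2)); under eq_fun do rewrite cosBpihalf.
by move=> ->; case: ifP; rewrite ?cosN ?cos_pihalf ?mulr0.
Qed.

Lemma integrable_trig (f : sfield R) : trig f -> mu.-integrable setT (EFin \o f).
Proof.
move=> tf; apply/Lfun1_integrable/Lfun_subset12.
  by rewrite ge0_fin_numE //; exact: torus_fin.
exact: trig_Lfun2.
Qed.

Lemma integD (f g : sfield R) : trig f -> trig g ->
  integ (fun x => f x + g x) = integ f + integ g.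
Proof. by move=> tf tg; apply: RintegralD => //; exact: integrable_trig. Qed.

Lemma integZ (c : R) (f : sfield R) : trig f ->
  integ (fun x => c * f x) = c * integ f.
Proof. by move=> tf; apply: RintegralZl => //; exact: integrable_trig. Qed.

Lemma wave_eq0B N (k m : waves N) :
  (freq k.1 - freq m.1 == 0) && (freq k.2 - freq m.2 == 0) = (k == m).
Proof. by rewrite !subr_eq0 !freq_eq; case: k m => [? ?] [? ?]. Qed.

Lemma wave_eq0D N (k m : waves N) :
  (freq k.1 + freq m.1 == 0) && (freq k.2 + freq m.2 == 0) = (k == opp_wave m).
Proof. by rewrite -wave_eq0B /= !freq_rev !opprK. Qed.

(** The two waves may have different index ranges, because [spectral_gap] pairs waves of a
    truncation at [n] with those of [fsum N]. *)
Lemma dotp_cosk_gen N n (k : waves N) (m : waves n) :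
  dotp mu (cosk k) (cosk m) = (2 * pi) ^+ 2 / 2 *
    (((freq k.1 - freq m.1 == 0) && (freq k.2 - freq m.2 == 0))%:R +
     ((freq k.1 + freq m.1 == 0) && (freq k.2 + freq m.2 == 0))%:R).
Proof.
rewrite mulrDr.
pose f a b : sfield R := fun x => 2^-1 * cos (lin a b x).
have tf a b : trig (f a b) by apply/trig_scale/trig_cos.
transitivity (integ (fun x => f (freq k.1 - freq m.1) (freq k.2 - freq m.2) x +
                              f (freq k.1 + freq m.1) (freq k.2 + freq m.2) x)).
  rewrite /dotp /integ; congr Rintegral; apply/funext => x.
  by rewrite /cosk /f !phaseE linB linD cosB cosD; field.
rewrite integD // !integZ ?integ_cos_lin; [ring|exact: trig_cos..].
Qed.

Lemma dotp_cosk N (k m : waves N) : dotp mu (cosk k) (cosk m) =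
  (2 * pi) ^+ 2 / 2 * ((k == m)%:R + (k == opp_wave m)%:R).
Proof. by rewrite dotp_cosk_gen wave_eq0B wave_eq0D. Qed.

Lemma dotp_sink_gen N n (k : waves N) (m : waves n) :
  dotp mu (sink k) (sink m) = (2 * pi) ^+ 2 / 2 *
    (((freq k.1 - freq m.1 == 0) && (freq k.2 - freq m.2 == 0))%:R -
     ((freq k.1 + freq m.1 == 0) && (freq k.2 + freq m.2 == 0))%:R).
Proof.
rewrite mulrBr.
pose f c a b : sfield R := fun x => c * cos (lin a b x).
have tf c a b : trig (f c a b) by apply/trig_scale/trig_cos.
transitivity (integ (fun x => f 2^-1 (freq k.1 - freq m.1) (freq k.2 - freq m.2) x +
                              f (- 2^-1) (freq k.1 + freq m.1) (freq k.2 + freq m.2) x)).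
  rewrite /dotp /integ; congr Rintegral; apply/funext => x.
  by rewrite /sink /f !phaseE linB linD cosB cosD; field.
rewrite integD // !integZ ?integ_cos_lin; [ring|exact: trig_cos..].
Qed.

Lemma dotp_sink N (k m : waves N) : dotp mu (sink k) (sink m) =
  (2 * pi) ^+ 2 / 2 * ((k == m)%:R - (k == opp_wave m)%:R).
Proof. by rewrite dotp_sink_gen wave_eq0B wave_eq0D. Qed.

Lemma dotp_sink_cosk N n (k : waves N) (m : waves n) :
  dotp mu (sink k) (cosk m) = 0.
Proof.
pose f a b : sfield R := fun x => 2^-1 * sin (lin a b x).
have tf a b : trig (f a b) by apply/trig_scale/trig_sin.
transitivity (integ (fun x => f (freq k.1 - freq m.1) (freq k.2 - freq m.2) x +
                              f (freq k.1 + freq m.1) (freq k.2 + freq m.2) x)).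
  rewrite /dotp /integ; congr Rintegral; apply/funext => x.
  by rewrite /sink /cosk /f !phaseE linB linD sinB sinD; field.
by rewrite integD // !integZ ?integ_sin_lin ?mulr0 ?addr0 //; exact: trig_sin.
Qed.

Lemma trig_sum (I : Type) (s : seq I) (P : pred I) (F : I -> sfield R) :
  (forall i, trig (F i)) -> trig (fun x => \sum_(i <- s | P i) F i x).
Proof.
move=> tF; elim: s => [|i s IH].
  by apply: trig_ext (trig_scale 0 (@trig1 R)) _ => x; rewrite big_nil mul0r.
case Pi: (P i).
  by apply: trig_ext (trig_add (tF i) IH) _ => x; rewrite big_cons Pi.
by apply: trig_ext IH _ => x; rewrite big_cons Pi.
Qed.

Lemma trig_cosk N (k : waves N) : trig (cosk k : sfield R).
Proof. by rewrite /cosk phaseE; exact: trig_cos. Qed.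

Lemma trig_sink N (k : waves N) : trig (sink k : sfield R).
Proof. by rewrite /sink phaseE; exact: trig_sin. Qed.

Lemma trig_fsum N g : trig (fsum N g).
Proof.
by apply: trig_sum => k; apply: trig_add; apply: trig_scale;
  [exact: trig_cosk|exact: trig_sink].
Qed.

Lemma Lfun2_fsum N g : fsum N g \in Lfun mu 2%:E.
Proof. by apply: trig_Lfun2; exact: trig_fsum. Qed.

#[local] Hint Resolve Lfun2_fsum : core.

Lemma dotp_fsuml N g h : h \in Lfun mu 2%:E -> dotp mu (fsum N g) h =
  \sum_(k : waves N | lowfreq k)
    (2 * pi) ^- 2 * (dotp mu g (cosk k) * dotp mu h (cosk k) +
                     dotp mu g (sink k) * dotp mu h (sink k)).
Proof.
move=> Lh; rewrite /fsum dotp_suml //; last first.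
  by move=> k _; apply: Lfun2_add; apply: Lfun2_scale.
apply: eq_bigr => k _; rewrite dotpDl ?dotpZl //; try exact: Lfun2_scale.
by rewrite (dotpC mu h) (dotpC mu h); ring.
Qed.

Lemma sum_lowfreq_delta N (F : waves N -> R) m : lowfreq m ->
  \sum_(k | lowfreq k) F k * (k == m)%:R = F m.
Proof.
move=> Pm; rewrite (bigD1 m) //= eqxx mulr1 big1 ?addr0 //.
by move=> k /andP[_ /negbTE ->]; rewrite mulr0.
Qed.

Lemma twopi_neq0 : (2 * pi) != 0 :> R.
Proof. by rewrite gt_eqF // twopi_gt0. Qed.

Lemma cosk_opp N (k : waves N) : cosk (opp_wave k) = cosk k :> sfield R.
Proof. by apply/funext => x; rewrite /cosk phase_opp cosN. Qed.

Lemma sink_opp N (k : waves N) :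
  sink (opp_wave k) = (fun x => -1 * sink k x) :> sfield R.
Proof. by apply/funext => x; rewrite /sink phase_opp sinN mulN1r. Qed.

(** The terms [k = m] and [k = -m] contribute one half each; for [m = 0] they are one term that
    counts twice, so no case distinction is needed. *)
Lemma dotp_fsum_cosk N g (m : waves N) : g \in Lfun mu 2%:E -> lowfreq m ->
  dotp mu (fsum N g) (cosk m) = dotp mu g (cosk m).
Proof.
move=> Lg Pm; rewrite dotp_fsuml //.
transitivity (2^-1 * \sum_(k | lowfreq k) dotp mu g (cosk k) * (k == m)%:R +
  2^-1 * \sum_(k | lowfreq k) dotp mu g (cosk k) * (k == opp_wave m)%:R).
  rewrite !mulr_sumr -big_split /=; apply: eq_bigr => k _.
  rewrite (dotpC mu (cosk m)) (dotpC mu (cosk m)) dotp_cosk dotp_sink_cosk.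
  by have := twopi_neq0; move: (2 * pi) => p p0; field.
rewrite !(sum_lowfreq_delta (fun k => dotp mu g (cosk k))) ?lowfreq_opp //.
by rewrite cosk_opp; field.
Qed.

Lemma dotp_fsum_sink N g (m : waves N) : g \in Lfun mu 2%:E -> lowfreq m ->
  dotp mu (fsum N g) (sink m) = dotp mu g (sink m).
Proof.
move=> Lg Pm; rewrite dotp_fsuml //.
transitivity (2^-1 * \sum_(k | lowfreq k) dotp mu g (sink k) * (k == m)%:R -
  2^-1 * \sum_(k | lowfreq k) dotp mu g (sink k) * (k == opp_wave m)%:R).
  rewrite !mulr_sumr -sumrB /=; apply: eq_bigr => k _.
  rewrite (dotpC mu (sink m) (sink k)) dotp_sink dotp_sink_cosk.
  by have := twopi_neq0; move: (2 * pi) => p p0; field.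
rewrite !(sum_lowfreq_delta (fun k => dotp mu g (sink k))) ?lowfreq_opp //.
by rewrite sink_opp dotpZr //; field.
Qed.

(** The Pythagorean identity, Bessel's inequality and the best approximation property all rest on
    this orthogonality. *)
Lemma dotp_fsum_residual N g h : g \in Lfun mu 2%:E ->
  dotp mu (fun x => g x - fsum N g x) (fsum N h) = 0.
Proof.
move=> Lg; rewrite dotpC dotp_fsuml; last exact: Lfun2_sub.
rewrite big1 // => k Pk; rewrite !dotpBl // dotp_fsum_cosk // dotp_fsum_sink //.
ring.
Qed.

Lemma sqnorm_fsum_residual N g : g \in Lfun mu 2%:E ->
  sqnorm mu (fun x => g x - fsum N g x) = sqnorm mu g - dotp mu (fsum N g) g.
Proof.
move=> Lg; have Lr : (fun x => g x - fsum N g x) \in Lfun mu 2%:E by exact: Lfun2_sub.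
by rewrite /sqnorm dotpBr // dotp_fsum_residual // subr0 dotpBl.
Qed.

Lemma Bessel N g : g \in Lfun mu 2%:E -> dotp mu (fsum N g) g <= sqnorm mu g.
Proof. by move=> Lg; rewrite -subr_ge0 -sqnorm_fsum_residual // sqnorm_ge0. Qed.

Lemma trig_fsum_residual (t : sfield R) : trig t ->
  exists n, forall N g, (n <= N)%N -> g \in Lfun mu 2%:E ->
    dotp mu (fun x => g x - fsum N g x) t = 0.
Proof.
(* From [|a| + |b| <= N] follows [a^2 + b^2 <= N^2], so the sum of absolute frequencies serves as a
   degree. *)
have wE N (a b : int) : (absz a + absz b <= N)%N ->
    exists2 k : waves N, lowfreq k & phase k = lin a b :> (R * R -> R).
  move=> abN; have aN := leq_trans (leq_addr _ _) abN.
  have bN := leq_trans (leq_addl _ _) abN.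
  exists (inord (absz (a + N%:Z)), inord (absz (b + N%:Z))).
    rewrite lowfreqE /= !freq_inord //.
    have ab : `|a%:~R| + `|b%:~R| <= N%:R :> R.
      by rewrite -!intr_norm -!abszE -!pmulrn -natrD ler_nat.
    apply: (@le_trans _ _ ((`|a%:~R| + `|b%:~R|) ^+ 2)).
      rewrite sqrrD !real_normK ?num_real // [leRHS]addrAC lerDl.
      by rewrite mulrn_wge0 // mulr_ge0.
    by rewrite lerXn2r ?nnegrE ?addr_ge0.
  by rewrite phaseE /= !freq_inord.
elim=> {t} [a b|a b|f g tf [n fn] tg [m gm]|c f tf [n fn]].
- exists (absz a + absz b)%N => N g abN Lg; have [k Pk kE] := wE N a b abN.
  have := dotp_fsum_cosk Lg Pk; rewrite /cosk kE => fk.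
  by rewrite dotpBl // ?fk ?subrr //; have := Lfun2_cosk k; rewrite /cosk kE.
- exists (absz a + absz b)%N => N g abN Lg; have [k Pk kE] := wE N a b abN.
  have := dotp_fsum_sink Lg Pk; rewrite /sink kE => fk.
  by rewrite dotpBl // ?fk ?subrr //; have := Lfun2_sink k; rewrite /sink kE.
- exists (maxn n m) => N h; rewrite geq_max => /andP[nN mN] Lh.
  rewrite dotpDr; [|exact: trig_Lfun2|exact: trig_Lfun2|exact: Lfun2_sub].
  by rewrite fn // gm // addr0.
- exists n => N h nN Lh.
  rewrite dotpZr; [|exact: trig_Lfun2|exact: Lfun2_sub].
  by rewrite fn // mulr0.
Qed.

(* [fsum N g] is the best approximation of [g] among trigonometric polynomials
   of degree at most [N], and these are dense. *)
Lemma sqnorm_fsum_cvg g : g \in Lfun mu 2%:E ->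
  forall e, 0 < e -> exists n, forall N, (n <= N)%N ->
    sqnorm mu (fun x => g x - fsum N g x) < e.
Proof.
move=> Lg e e0; have [_ /(_ e e0) [t tt gt]] := trig_dense Lg.
have [n nt] := trig_fsum_residual tt; exists n => N nN.
apply: le_lt_trans gt.
have Lt : t \in Lfun mu 2%:E := trig_Lfun2 tt.
have Lr : (fun x => g x - fsum N g x) \in Lfun mu 2%:E by exact: Lfun2_sub.
have Ls : (fun x => t x - fsum N g x) \in Lfun mu 2%:E by exact: Lfun2_sub.
rewrite (_ : (fun x => g x - t x) =
  fun x => (g x - fsum N g x) - (t x - fsum N g x)); last first.
  by apply/funext => x; ring.
rewrite [leRHS]/sqnorm dotp_sqrB //.
rewrite [X in _ - 2 * X](_ : _ = 0); first by rewrite mulr0 subr0 lerDl dotp_ge0.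
by rewrite dotpBr // nt // dotp_fsum_residual // subrr.
Qed.

(** Parseval's identity as a limit, by Cauchy-Schwarz against the residual. Relations checked wave
    by wave pass to L2 through it. *)
Lemma dotp_fsum_cvg f g : f \in Lfun mu 2%:E -> g \in Lfun mu 2%:E ->
  dotp mu f (fsum N g) @[N --> \oo] --> dotp mu f g.
Proof.
move=> Lf Lg; apply/cvgrPdist_lt => e e0.
have f0 := sqnorm_ge0 mu f.
have fp : 0 < sqnorm mu f + 1 by lra.
have [n Hn] := sqnorm_fsum_cvg Lg (divr_gt0 (exprn_gt0 2 e0) fp).
exists n => // N /= nN; rewrite -dotpBr //.
have Lr : (fun x => g x - fsum N g x) \in Lfun mu 2%:E by exact: Lfun2_sub.
rewrite -(@ltr_pXn2r _ 2) ?nnegrE ?(ltW e0) // real_normK ?num_real //.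
apply: le_lt_trans (CauchySchwarz Lf Lr) _.
have := Hn _ nN; rewrite ltr_pdivlMr // => Hs.
apply: le_lt_trans Hs; rewrite mulrC ler_wpM2l ?sqnorm_ge0 // lerDl //.
Qed.

End FourierSums.

(** * Weak derivatives *)

Section WeakDerivatives.
Variable R : realType.
Local Notation mu := (torus R).
Local Notation waves N := ('I_N.*2.+1 * 'I_N.*2.+1)%type.
Implicit Types (f g t psi : sfield R) (j : 'I_2).

(** Reduces a directional derivative to one-variable calculus along a line. *)
Lemma is_derive_line f (x v : R * R) (g : R -> R) (dg : R) :
  (forall h, f (h *: v + x) = g h) -> is_derive (0 : R) (1 : R) g dg ->
  is_derive x v f dg.
Proof.
move=> fg [dg1 dg2].
have E : (fun h => h^-1 *: ((f \o shift x) (h *: v) - f x)) =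
         (fun h => h^-1 *: ((g \o shift 0) (h *: 1) - g 0)).
  apply/funext => h /=; rewrite -[f x](_ : f (0 *: v + x) = _); last first.
    by rewrite scale0r add0r.
  by rewrite !fg addr0 /GRing.scale /= mulr1.
by apply: DeriveDef; rewrite /derivable /derive E.
Qed.

Definition dirfreq j (a b : int) : R := (if j == ord0 then a else b)%:~R.

Lemma lin_dir j a b (h : R) (x : R * R) :
  lin a b (h *: dir R j + x) = h * dirfreq j a b + lin a b x.
Proof.
by rewrite /lin /dirfreq /dir; case: ifP => _; rewrite /= /GRing.scale /=; ring.
Qed.

Lemma is_derive_cos_lin j a b x :
  is_derive x (dir R j) (fun x => cos (lin a b x))
    (- dirfreq j a b * sin (lin a b x)).
Proof.
apply: (@is_derive_line _ _ _ (fun h => cos (h * dirfreq j a b + lin a b x))).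
  by move=> h; rewrite lin_dir.
apply: is_derive_eq.
by rewrite /GRing.scale /= mul0r add0r; ring.
Qed.

Lemma is_derive_sin_lin j a b x :
  is_derive x (dir R j) (fun x => sin (lin a b x))
    (dirfreq j a b * cos (lin a b x)).
Proof.
apply: (@is_derive_line _ _ _ (fun h => sin (h * dirfreq j a b + lin a b x))).
  by move=> h; rewrite lin_dir.
apply: is_derive_eq.
by rewrite /GRing.scale /= mul0r add0r; ring.
Qed.

(** Stability of [trig] under differentiation, which makes [Ck n] an induction on [n]. *)
Lemma trig_derive j t : trig t -> exists2 t', trig t' &
  forall x, is_derive x (dir R j) t (t' x).
Proof.
elim=> {t} [a b|a b|f g _ [f' tf' df] _ [g' tg' dg]|c f _ [f' tf' df]].
- eexists; last by move=> x; exact: is_derive_cos_lin.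
  by apply/trig_scale/trig_sin.
- eexists; last by move=> x; exact: is_derive_sin_lin.
  by apply/trig_scale/trig_cos.
- exists (fun x => f' x + g' x); first exact: trig_add.
  by move=> x; exact: is_deriveD.
- exists (fun x => c * f' x); first exact: trig_scale.
  by move=> x; exact: is_deriveZ.
Qed.

Lemma continuous_lin a b : continuous (@lin R a b).
Proof.
move=> x; apply: cvgD; (apply: cvgM; first exact: cvg_cst).
  exact: cvg_fst.
exact: cvg_snd.
Qed.

Lemma trig_continuous t : trig t -> continuous (t : R * R -> R).
Proof.
elim=> {t} [a b|a b|f g _ cf _ cg|c f _ cf] x.
- by apply: continuous_comp; [exact: continuous_lin|exact: continuous_cos].
- by apply: continuous_comp; [exact: continuous_lin|exact: continuous_sin].
- by apply: cvgD; [exact: cf|exact: cg].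
- by apply: cvgM; [exact: cvg_cst|exact: cf].
Qed.

Lemma trig_Ck n t : trig t -> Ck n t.
Proof.
elim: n t => [|n IH] t tt; split=> //; try exact: trig_continuous.
move=> j; have [t' tt' dt] := trig_derive j tt; split.
  by move=> x; case: (dt x).
rewrite (_ : 'D_(dir R j) t = t'); first exact: IH.
by apply/funext => x; case: (dt x).
Qed.

Lemma sinD2pi_int (a : int) (c : R) : sin (a%:~R * (2 * pi) + c) = sin c.
Proof. by rewrite -[in LHS]cosBpihalf -addrA cosD2pi_int cosBpihalf. Qed.

Lemma trig_periodic t : trig t ->
  forall x j, t (x + (2 * pi) *: dir R j) = t x.
Proof.
have linp a b x j : exists n : int,
    lin a b (x + (2 * pi) *: dir R j) = n%:~R * (2 * pi) + lin a b x.
  exists (if j == ord0 then a else b).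
  by rewrite addrC lin_dir /dirfreq [in LHS]mulrC.
elim=> {t} [a b|a b|f g _ pf _ pg|c f _ pf] x j.
- by have [n ->] := linp a b x j; rewrite cosD2pi_int.
- by have [n ->] := linp a b x j; rewrite sinD2pi_int.
- by rewrite pf pg.
- by rewrite pf.
Qed.

Lemma trig_test t : trig t -> test_function t.
Proof. by move=> tt; split; [move=> n; exact: trig_Ck|exact: trig_periodic]. Qed.

(** Since [cosk k] is itself a test function, the definition of the weak derivative yields its
    Fourier coefficients directly. *)
Lemma weak_derivative_cosk j f g N (k : waves N) : f \in Lfun mu 2%:E ->
  weak_derivative j f g ->
  dotp mu g (cosk k) = wave R k j * dotp mu f (sink k).
Proof.
move=> Lf [Lg H]; have D x : 'D_(dir R j) (cosk k) x = - wave R k j * sink k x.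
  rewrite /cosk /sink !phaseE.
  by case: (is_derive_cos_lin j (freq k.1) (freq k.2) x) => _ ->; rewrite waveE.
apply: oppr_inj; rewrite -mulNr -dotpZr ?Lfun2_sink //.
rewrite -[LHS](H _ (trig_test (@trig_cosk R _ k))).
by apply: eq_Rintegral => x _; rewrite D.
Qed.

Lemma weak_derivative_sink j f g N (k : waves N) : f \in Lfun mu 2%:E ->
  weak_derivative j f g ->
  dotp mu g (sink k) = - (wave R k j * dotp mu f (cosk k)).
Proof.
move=> Lf [Lg H]; have D x : 'D_(dir R j) (sink k) x = wave R k j * cosk k x.
  rewrite /cosk /sink !phaseE.
  by case: (is_derive_sin_lin j (freq k.1) (freq k.2) x) => _ ->; rewrite waveE.
apply: oppr_inj; rewrite opprK -dotpZr ?Lfun2_cosk //.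
rewrite -[LHS](H _ (trig_test (@trig_sink R _ k))).
by apply: eq_Rintegral => x _; rewrite D.
Qed.

(** Neither function is a test function, so the definition does not apply. The identity holds wave
    by wave, both sides carrying the factor [k_j], and passes to the limit. *)
Lemma dotp_weak_derivative j f f' g g' : f \in Lfun mu 2%:E -> g \in Lfun mu 2%:E ->
  weak_derivative j f f' -> weak_derivative j g g' ->
  dotp mu f g' = - dotp mu f' g.
Proof.
move=> Lf Lg ff' gg'; have Lf' : f' \in Lfun mu 2%:E by case: ff'.
have Lg' : g' \in Lfun mu 2%:E by case: gg'.
have E N : dotp mu f (fsum N g') = - dotp mu f' (fsum N g).
  rewrite dotpC (dotpC mu f') !dotp_fsuml // -sumrN; apply: eq_bigr => k _.
  rewrite (weak_derivative_cosk _ Lg gg') (weak_derivative_sink _ Lg gg').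
  rewrite (weak_derivative_cosk _ Lf ff') (weak_derivative_sink _ Lf ff'); ring.
have h2 : dotp mu f (fsum N g') @[N --> \oo] --> - dotp mu f' g.
  by rewrite (funext E); apply: cvgN; exact: dotp_fsum_cvg.
rewrite -(cvg_lim (@Rhausdorff R) (dotp_fsum_cvg Lf Lg')).
by rewrite (cvg_lim (@Rhausdorff R) h2).
Qed.

(** [M] is kept apart from [N] to serve two cases: [M = N] for the high modes, and [N = 0], [M = 1]
    for Poincare's inequality, where integrality of the wavenumbers supplies the gap. *)
Lemma spectral_gap N (M : R) g (g' : 'I_2 -> sfield R) : g \in Lfun mu 2%:E ->
  (forall j, weak_derivative j g (g' j)) ->
  (forall a b : int, N%:R ^+ 2 < a%:~R ^+ 2 + b%:~R ^+ 2 :> R ->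
     M ^+ 2 <= a%:~R ^+ 2 + b%:~R ^+ 2) ->
  M ^+ 2 * (sqnorm mu g - dotp mu (fsum N g) g) <= \sum_j sqnorm mu (g' j).
Proof.
move=> Lg gg' gap; have Lg' j : g' j \in Lfun mu 2%:E by case: (gg' j).
rewrite -sqnorm_fsum_residual //; set r := fun x => _.
have Lr : r \in Lfun mu 2%:E by apply: Lfun2_sub => //; exact: Lfun2_fsum.
(* Wave by wave on a truncation at [n]: the residual has no coefficients up to [N], and beyond [N]
   it has those of [g], where the gap applies. *)
have bound n : M ^+ 2 * dotp mu r (fsum n r) <= \sum_j sqnorm mu (g' j).
  apply: (@le_trans _ _ (\sum_j dotp mu (fsum n (g' j)) (g' j))); last first.
    by apply: ler_sum => j _; exact: Bessel.
  under eq_bigr do rewrite dotp_fsuml //.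
  rewrite exchange_big /= dotpC dotp_fsuml // mulr_sumr.
  apply: ler_sum => k _; rewrite -mulr_sumr mulrCA.
  apply: ler_wpM2l; first by rewrite invr_ge0 sqr_ge0.
  rewrite (_ : \sum_j _ = ((freq k.1)%:~R ^+ 2 + (freq k.2)%:~R ^+ 2) *
     (dotp mu g (cosk k) ^+ 2 + dotp mu g (sink k) ^+ 2)); last first.
    rewrite big_ord_recl big_ord1.
    rewrite !(weak_derivative_cosk _ Lg (gg' _)) !(weak_derivative_sink _ Lg (gg' _)).
    by rewrite !waveE /=; ring.
  have [low|high] := leP ((freq k.1)%:~R ^+ 2 + (freq k.2)%:~R ^+ 2 : R) (N%:R ^+ 2).
    have le1 (a b : int) : (a%:~R ^+ 2 + b%:~R ^+ 2 : R) <= N%:R ^+ 2 ->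
        (absz a <= N)%N.
      move=> ab; rewrite -(ler_nat R) -(@ler_pXn2r _ 2) ?nnegrE //.
      rewrite natr_absz intr_norm real_normK ?num_real //.
      by apply: le_trans ab; rewrite lerDl sqr_ge0.
    (* The same wavenumber, re-indexed in the range of [fsum N]. *)
    pose k' : waves N :=
      (inord (absz (freq k.1 + N%:Z)), inord (absz (freq k.2 + N%:Z))).
    have l1 := le1 _ _ low.
    have l2 : (absz (freq k.2) <= N)%N by apply: (le1 _ (freq k.1)); rewrite addrC.
    have kk' : phase k' = phase k :> (R * R -> R).
      by rewrite !phaseE /= !freq_inord.
    have low' : lowfreq R k' by rewrite lowfreqE /= !freq_inord.
    have -> : dotp mu r (cosk k) = 0.
      rewrite /cosk -kk' dotpBl ?(Lfun2_cosk k') ?Lfun2_fsum //;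
        last exact: Lfun2_cosk.
      by have := dotp_fsum_cosk Lg low'; rewrite /cosk => ->; rewrite subrr.
    have -> : dotp mu r (sink k) = 0.
      rewrite /sink -kk' dotpBl ?(Lfun2_sink k') ?Lfun2_fsum //;
        last exact: Lfun2_sink.
      by have := dotp_fsum_sink Lg low'; rewrite /sink => ->; rewrite subrr.
    by rewrite !mulr0 addr0 mulr0 mulr_ge0 // addr_ge0 // sqr_ge0.
  (* The values [e = 1] and [e = -1] exclude [k = -m] and [k = m]: either would give
     [|k| = |m| <= N]. *)
  have neq (m : waves N) (e : int) : e ^+ 2 = 1 -> lowfreq R m ->
      (freq k.1 + e * freq m.1 == 0) && (freq k.2 + e * freq m.2 == 0) = false.
    move=> e1 lm; apply/negP; rewrite !addr_eq0 => /andP[/eqP k1 /eqP k2].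
    move: lm; rewrite lowfreqE leNgt; move: high; rewrite k1 k2 !intrN !sqrrN.
    rewrite !intrM !exprMn -[e%:~R ^+ 2]rmorphXn /= e1 !mul1r.
    by move=> ->.
  have rg_cos : dotp mu r (cosk k) = dotp mu g (cosk k).
    rewrite dotpBl ?Lfun2_fsum ?Lfun2_cosk // dotp_fsuml ?Lfun2_cosk //.
    rewrite big1 ?subr0 // => m lm.
    rewrite dotp_cosk_gen (dotpC mu (cosk k) (sink m)) dotp_sink_cosk.
    have := neq m 1 (expr1n _ _) lm; have := neq m (-1) (sqrrN _) lm.
    by rewrite !mul1r !mulN1r => -> ->; rewrite addr0 !mulr0 addr0 mulr0.
  have rg_sin : dotp mu r (sink k) = dotp mu g (sink k).
    rewrite dotpBl ?Lfun2_fsum ?Lfun2_sink // dotp_fsuml ?Lfun2_sink //.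
    rewrite big1 ?subr0 // => m lm.
    rewrite dotp_sink_gen dotp_sink_cosk.
    have := neq m 1 (expr1n _ _) lm; have := neq m (-1) (sqrrN _) lm.
    by rewrite !mul1r !mulN1r => -> ->; rewrite subr0 !mulr0 addr0 mulr0.
  rewrite rg_cos rg_sin -!expr2; apply: ler_wpM2r; last exact: gap.
  by rewrite addr_ge0 // sqr_ge0.
have lim : M ^+ 2 * dotp mu r (fsum n r) @[n --> \oo] --> M ^+ 2 * sqnorm mu r.
  by apply: cvgM; [exact: cvg_cst|exact: dotp_fsum_cvg].
rewrite -(cvg_lim (@Rhausdorff R) lim); apply: limr_le.
  exact: (cvgP _ lim).
exact: nearW.
Qed.

Lemma integ_dotp1 g : integ g = dotp mu g (fun=> 1).
Proof. by apply: eq_Rintegral => x _; rewrite mulr1. Qed.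

Lemma Poincare_scalar g (g' : 'I_2 -> sfield R) : g \in Lfun mu 2%:E ->
  integ g = 0 -> (forall j, weak_derivative j g (g' j)) ->
  sqnorm mu g <= \sum_j sqnorm mu (g' j).
Proof.
move=> Lg g0 gg'; have := @spectral_gap 0 1 g g' Lg gg'.
rewrite expr1n mul1r dotp_fsuml // big1 ?subr0.
  apply=> a b; rewrite expr0n /= -!rmorphXn /= -rmorphD /=.
  by rewrite ltr0z gtz0_ge1 -(ler_int R).
(* For [N = 0] the only index is the zero wave, whose coefficient is the mean of [g]. *)
move=> k _; have k0 : phase k = (fun=> 0) :> (R * R -> R).
  apply/funext => x; rewrite phaseE /freq.
  by case: k => [[[|//] ?] [[|//] ?]] /=; rewrite lin0.
have c1 : cosk k = (fun=> 1) :> sfield R.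
  by apply/funext => x; rewrite /cosk k0 cos0.
have s0 : sink k = (fun=> 0) :> sfield R.
  by apply/funext => x; rewrite /sink k0 sin0.
by rewrite c1 s0 -integ_dotp1 g0 (dotpC mu g) dotp0l !mulr0 addr0 mulr0.
Qed.

End WeakDerivatives.

(** * Vector fields *)

Section VectorFields.
Variable R : realType.
Local Notation mu := (torus R).
Implicit Types (u v w z phi : vfield R) (f F K : sfield R).

Definition gradip u v : R :=
  \sum_i \sum_j dotp mu (wD j (u i)) (wD j (v i)).

Lemma ipE u v : vL2 u -> vL2 v -> ip u v = \sum_i dotp mu (u i) (v i).
Proof.
move=> Lu Lv; rewrite /ip /integ /dotp !big_ord_recl !big_ord0.
under eq_Rintegral do rewrite !big_ord_recl big_ord0 addr0.
by rewrite RintegralD ?addr0 //; exact: (integrable_mul (Lu _) (Lv _)).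
Qed.

Lemma vL2D u v : vL2 u -> vL2 v -> vL2 (u + v).
Proof. by move=> Lu Lv i; exact: (Lfun2_add (Lu i) (Lv i)). Qed.

Lemma vL2N u : vL2 u -> vL2 (- u).
Proof. by move=> Lu i; exact: (Lfun2_opp (Lu i)). Qed.

Lemma vL2Z (c : R) u : vL2 u -> vL2 (c *: u).
Proof. by move=> Lu i; exact: (Lfun2_scale c (Lu i)). Qed.

Lemma ipDl u v w : vL2 u -> vL2 v -> vL2 w -> ip (u + v) w = ip u w + ip v w.
Proof.
move=> Lu Lv Lw; rewrite !ipE //; last exact: vL2D.
by rewrite -big_split; apply: eq_bigr => i _; exact: (dotpDl (Lu i) (Lv i) (Lw i)).
Qed.

Lemma ipNl u w : vL2 u -> vL2 w -> ip (- u) w = - ip u w.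
Proof.
move=> Lu Lw; rewrite !ipE //; last exact: vL2N.
by rewrite -sumrN; apply: eq_bigr => i _; exact: (dotpNl (Lu i) (Lw i)).
Qed.

Lemma ipZl (c : R) u w : vL2 u -> vL2 w -> ip (c *: u) w = c * ip u w.
Proof.
move=> Lu Lw; rewrite !ipE //; last exact: vL2Z.
by rewrite mulr_sumr; apply: eq_bigr => i _; exact: (dotpZl c (Lu i) (Lw i)).
Qed.

Lemma ip_vae u v w : vL2 u -> vL2 v -> vL2 w -> vae u v -> ip u w = ip v w.
Proof.
move=> Lu Lv Lw uv; rewrite !ipE //; apply: eq_bigr => i _.
exact: (dotp_ae (Lu i) (Lv i) (Lw i) (uv i)).
Qed.

Lemma ip_ge0 u : 0 <= ip u u.
Proof.
by apply: Rintegral_ge0 => x _; apply: sumr_ge0 => i _; rewrite -expr2 sqr_ge0.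
Qed.

Lemma normH_sqr u : normH u ^+ 2 = ip u u.
Proof. by rewrite sqr_sqrtr // ip_ge0. Qed.

Lemma gradip_ge0 u : 0 <= gradip u u.
Proof. by apply: sumr_ge0 => i _; apply: sumr_ge0 => j _; exact: dotp_ge0. Qed.

Lemma gradipC u v : gradip u v = gradip v u.
Proof. by apply: eq_bigr => i _; apply: eq_bigr => j _; rewrite dotpC. Qed.

Lemma normV_sqr u : normV u ^+ 2 = gradip u u.
Proof. by rewrite sqr_sqrtr; last exact: gradip_ge0. Qed.

Lemma wDP f j : weakly_derivable f -> weak_derivative j f (wD j f).
Proof. by move=> /(_ j) wf; exact: xgetPex. Qed.

Lemma inV_vL2 u : inV u -> vL2 u. Proof. by case=> -[]. Qed.

Lemma inV_wD u i j : inV u -> weak_derivative j (u i) (wD j (u i)).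
Proof. by case=> _ wu; exact: wDP. Qed.

Lemma inV_Lfun_wD u i j : inV u -> wD j (u i) \in Lfun mu 2%:E.
Proof. by move=> /(inV_wD i j) []. Qed.

Lemma inDA_wD2 u i j : inDA u -> weak_derivative j (wD j (u i)) (wD j (wD j (u i))).
Proof. by case=> _ wu; exact: wDP. Qed.

Lemma vL2_stokes u : inDA u -> vL2 (stokes u).
Proof.
move=> Du i; apply: Lfun2_opp; apply: Lfun2_sum => j _.
by case: (inDA_wD2 i j Du).
Qed.

Lemma ip_stokes u w : inDA u -> inV w -> ip (stokes u) w = gradip u w.
Proof.
move=> Du Vw; have Lw := inV_vL2 Vw; have Vu : inV u by case: Du.
rewrite ipE //; last exact: vL2_stokes.
apply: eq_bigr => i _; have L2D j : wD j (wD j (u i)) \in Lfun mu 2%:E.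
  by case: (inDA_wD2 i j Du).
transitivity (- dotp mu (fun x => \sum_j wD j (wD j (u i)) x) (w i)).
  by apply: dotpNl; [exact: Lfun2_sum|exact: Lw].
rewrite dotp_suml //; last exact: Lw.
rewrite -sumrN; apply: eq_bigr => j _; rewrite dotpC.
rewrite (dotp_weak_derivative (Lw i) (inV_Lfun_wD i j Vu) (inV_wD i j Vw)
  (inDA_wD2 i j Du)).
by rewrite opprK dotpC.
Qed.

Lemma vL2_PN N u : vL2 (PN N u).
Proof. by move=> i; rewrite PN_fsum; exact: Lfun2_fsum. Qed.

Lemma ip_PN N u v : vL2 v -> ip (PN N u) v = \sum_i dotp mu (fsum N (u i)) (v i).
Proof. by move=> Lv; rewrite ipE //; exact: vL2_PN. Qed.

Lemma ip_PNC N u v : vL2 u -> vL2 v -> ip (PN N u) v = ip (PN N v) u.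
Proof.
move=> Lu Lv; rewrite !ip_PN //; apply: eq_bigr => i _.
rewrite !dotp_fsuml; [|exact: Lu|exact: Lv]; apply: eq_bigr => k _.
by congr (_ * _); rewrite mulrC; congr (_ + _); rewrite mulrC.
Qed.

Lemma ip_PN_ge0 N u : vL2 u -> 0 <= ip (PN N u) u.
Proof.
move=> Lu; rewrite ip_PN //; apply: sumr_ge0 => i _.
rewrite dotp_fsuml; last exact: Lu; apply: sumr_ge0 => k _.
by rewrite mulr_ge0 ?invr_ge0 ?sqr_ge0 // addr_ge0 // -expr2 sqr_ge0.
Qed.

Lemma ip_PN_le N u : vL2 u -> ip (PN N u) u <= ip u u.
Proof.
move=> Lu; rewrite ip_PN // ipE //; apply: ler_sum => i _.
by apply: Bessel; exact: Lu.
Qed.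

Lemma vector_spectral_gap N u : inV u ->
  N%:R ^+ 2 * (ip u u - ip (PN N u) u) <= gradip u u.
Proof.
move=> Vu; have Lu := inV_vL2 Vu; rewrite ip_PN // ipE // -sumrB mulr_sumr.
apply: ler_sum => i _; apply: (spectral_gap (g' := fun j => wD j (u i))).
- exact: Lu.
- by move=> j; exact: inV_wD.
- by move=> a b /ltW.
Qed.

Lemma Poincare u : inV u -> ip u u <= gradip u u.
Proof.
move=> Vu; have Lu := inV_vL2 Vu; rewrite ipE //; apply: ler_sum => i _.
apply: (Poincare_scalar (g' := fun j => wD j (u i))).
- exact: Lu.
- by case: Vu => -[].
- by move=> j; exact: inV_wD.
Qed.

Lemma ip_eq0_vae u : vL2 u -> ip u u = 0 -> vae u 0.
Proof.
move=> Lu; rewrite ipE // => /eqP.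
rewrite psumr_eq0; last by move=> i _; exact: dotp_ge0.
move=> /allP u0 i; apply: (dotp_eq0 (Lu i)); apply/eqP.
by apply: u0; rewrite mem_index_enum.
Qed.

Lemma CauchySchwarz_ip u v : vL2 u -> vL2 v -> ip u v ^+ 2 <= ip u u * ip v v.
Proof.
move=> Lu Lv.
(* Combines the Cauchy-Schwarz bounds of the two components, in squared form. *)
have CS2 (a b c d p q : R) : 0 <= a -> 0 <= b -> 0 <= c -> 0 <= d ->
    p ^+ 2 <= a * b -> q ^+ 2 <= c * d -> (p + q) ^+ 2 <= (a + c) * (b + d).
  move=> a0 b0 c0 d0 pab qcd.
  suff : 2 * (p * q) <= a * d + c * b by nra.
  have h : (p * q) ^+ 2 <= ((a * d + c * b) / 2) ^+ 2.
    apply: (@le_trans _ _ ((a * b) * (c * d))).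
      by rewrite exprMn ler_pM ?sqr_ge0.
    by have := sqr_ge0 (a * d - c * b); nra.
  have s0 : 0 <= (a * d + c * b) / 2 by rewrite divr_ge0 // addr_ge0 // mulr_ge0.
  have : p * q <= (a * d + c * b) / 2.
    rewrite (le_trans (ler_norm _)) // -(@ler_pXn2r _ 2) ?nnegrE //.
    by rewrite real_normK ?num_real.
  by lra.
rewrite !ipE // !big_ord_recl !big_ord0 !addr0.
by apply: CS2; rewrite ?dotp_ge0 //; apply: CauchySchwarz; first [exact: Lu|exact: Lv].
Qed.

(** From [||u||^2 = (A u, u) <= |A u| |u|] and Poincare's inequality. It makes the logarithm in the
    Brezis-Gallouet inequality nonnegative. *)
Lemma ip_le_stokes u : inDA u -> gradip u u <= ip (stokes u) (stokes u).
Proof.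
move=> Du; have Vu : inV u by case: Du.
have := CauchySchwarz_ip (vL2_stokes Du) (inV_vL2 Vu); rewrite ip_stokes // => h.
have := Poincare Vu; have := gradip_ge0 u; rewrite le_eqVlt => /predU1P[<-|g0] p.
  by rewrite ip_ge0.
have := ip_ge0 (stokes u); have := ip_ge0 u; nra.
Qed.

End VectorFields.

(** * Bounds on the trilinear form *)

Section AdvectionBounds.
Variable R : realType.
Local Notation mu := (torus R).
Implicit Types (u v w z phi : vfield R) (f F K : sfield R).

Definition sqlen u : sfield R := fun x => \sum_i u i x ^+ 2.

Lemma sqlen_ge0 u x : 0 <= sqlen u x.
Proof. by apply: sumr_ge0 => i _; exact: sqr_ge0. Qed.

Lemma measurable_sqlen u : vL2 u -> measurable_fun setT
  (sqlen u : measurableTypeR R * measurableTypeR R -> R).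
Proof.
move=> Lu; apply: measurable_sum => i.
by apply: measurable_funX; exact: measurable_Lfun (Lu i).
Qed.

(** Writes a nonnegative integrable function as the square of an L2 function, so that Cauchy-Schwarz
    can split products of lengths. *)
Lemma Lfun2_sqrt (p : sfield R) :
  measurable_fun setT (p : measurableTypeR R * measurableTypeR R -> R) ->
  (forall x, 0 <= p x) -> mu.-integrable setT (EFin \o p) ->
  (fun x => Num.sqrt (p x)) \in Lfun mu 2%:E /\
  sqnorm mu (fun x => Num.sqrt (p x)) = integ p.
Proof.
move=> mp p0 Ip; split.
  apply/Lfun2P; split.
    have ms : measurable_fun setT (@Num.sqrt R).
      by apply: continuous_measurable_fun; exact: sqrt_continuous.
    exact: (measurableT_comp ms mp).
  by under eq_fun do rewrite sqr_sqrtr //.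
by apply: eq_Rintegral => x _; rewrite -expr2 sqr_sqrtr.
Qed.

(** The squared L^4 norm of [phi] is the L2 norm of [|phi|^2], and the bound makes it finite. The
    sign of the right side is read off from the inequality itself. *)
Lemma Ladyzhenskaya_sqlen cL phi : ladyzhenskaya cL -> inV phi ->
  [/\ 0 <= cL * normV phi * normH phi, sqlen phi \in Lfun mu 2%:E &
      sqnorm mu (sqlen phi) <= (cL * normV phi * normH phi) ^+ 2].
Proof.
move=> hL Vphi; have := hL _ Vphi; have Lphi := inV_vL2 Vphi.
rewrite /normLp; set X := cL * _ * _.
have := Lnorm_ge0 mu 4%:E (EFin \o euclid phi).
have := @powR_Lnorm _ _ _ mu (EFin \o euclid phi) 4 (lt0r_neq0 (ltr0n _ 4)).
have -> : (\int[mu]_x `|(EFin \o euclid phi) x| `^ 4 =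
    \int[mu]_x (sqlen phi x ^+ 2)%:E)%E.
  apply: eq_integral => x _ /=.
  rewrite ger0_norm ?sqrtr_ge0 // powR_mulrn ?sqrtr_ge0 //.
  by rewrite /euclid (exprM _ 2 2) sqr_sqrtr // sqlen_ge0.
(* Both infinite values are ruled out: [+oo] by the bound, [-oo] by nonnegativity of the norm. *)
case: ('N[mu]_4[_])%E => [y| |] //=.
rewrite lee_fin => Hy y0; rewrite -EFinM lee_fin => yX.
have mq : measurable_fun setT ((fun x => sqlen phi x ^+ 2) :
    measurableTypeR R * measurableTypeR R -> R).
  by apply: measurable_funX; exact: measurable_sqlen.
have X0 : 0 <= X by apply: le_trans yX; exact: sqr_ge0.
have Iq : mu.-integrable setT (EFin \o (fun x => sqlen phi x ^+ 2)).
  apply/integrableP; split; first exact/measurable_EFinP.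
  under eq_integral do rewrite /= ger0_norm ?sqr_ge0 //.
  by rewrite -Hy ltry.
split=> //; first by apply/Lfun2P; split=> //; exact: measurable_sqlen.
rewrite /sqnorm /dotp (_ : Rintegral _ _ _ = y `^ 4); last first.
  by rewrite /Rintegral -[RHS]/(fine (y `^ 4)%:E) Hy.
by rewrite powR_mulrn // (exprM _ 2 2) lerXn2r ?nnegrE ?sqr_ge0.
Qed.

Lemma ae_euclid_le phi (b : R) : (normLp +oo phi <= b%:E)%E ->
  {ae mu, forall x, euclid phi x <= b}.
Proof.
(* The norm at [+oo] is an essential supremum once the total measure is known to be positive, whence
   [torusT]. *)
rewrite /normLp unlock torusT lte_fin exprn_gt0 ?twopi_gt0 // => /ess_supP h.
refine (ae_imply h _) => x /=; rewrite lee_fin => hx.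
by rewrite (le_trans (ler_norm _)).
Qed.

Lemma sqr_integ_le f F K : mu.-integrable setT (EFin \o f) ->
  F \in Lfun mu 2%:E -> K \in Lfun mu 2%:E ->
  {ae mu, forall x, `|f x| <= F x * K x} ->
  integ f ^+ 2 <= sqnorm mu F * sqnorm mu K.
Proof.
move=> If LF LK fFK; apply: le_trans (CauchySchwarz LF LK).
have IFK := integrable_mul LF LK.
have mf : measurable_fun setT (f : measurableTypeR R * measurableTypeR R -> R).
  by apply/measurable_EFinP; exact: measurable_int If.
have mFK : measurable_fun setT ((fun x => F x * K x) :
    measurableTypeR R * measurableTypeR R -> R).
  by apply/measurable_EFinP; exact: measurable_int IFK.
have le1 : `|integ f| <= `|dotp mu F K|; last first.
  by rewrite -[leLHS]real_normK ?num_real // -[leRHS]real_normK ?num_real // lerXn2r.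
apply: le_trans (le_normr_Rintegral measurableT If) _.
apply: le_trans (ler_norm _); rewrite -lee_fin /dotp /Rintegral.
have Iaf := integrable_abse If.
rewrite (fineK (integrable_fin_num measurableT Iaf)).
rewrite (fineK (integrable_fin_num measurableT IFK)) /=.
rewrite [leRHS](_ : _ = (\int[mu]_x `|F x * K x|%:E)%E); last first.
  apply: ae_eq_integral => //.
  - exact/measurable_EFinP.
  - by apply/measurable_EFinP; exact: measurableT_comp.
  - refine (ae_imply fFK _) => x hx _ /=.
    by rewrite ger0_norm // (le_trans _ hx).
apply: ae_ge0_le_integral => //.
- by apply/measurable_EFinP; exact: measurableT_comp.
- by apply/measurable_EFinP; exact: measurableT_comp.
- refine (ae_imply fFK _) => x hx _.
  by rewrite lee_fin (le_trans hx) // ler_norm.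
Qed.

Lemma sum2_CauchySchwarz (a b : 'I_2 -> R) :
  (\sum_i a i * b i) ^+ 2 <= (\sum_i a i ^+ 2) * (\sum_i b i ^+ 2).
Proof.
rewrite !big_ord_recl !big_ord0 !addr0; set p := a _; set q := a _.
set r := b _; set s := b _; rewrite -subr_ge0.
rewrite (_ : _ - _ = (p * s - q * r) ^+ 2) ?sqr_ge0 //; ring.
Qed.

Definition sqgrad v : sfield R := fun x => \sum_i \sum_j wD j (v i) x ^+ 2.

Lemma sqgrad_ge0 v x : 0 <= sqgrad v x.
Proof. by apply: sumr_ge0 => i _; apply: sumr_ge0 => j _; exact: sqr_ge0. Qed.

(** Cauchy-Schwarz in R^2 twice, over components and over derivative indices; this produces the
    Frobenius length of the gradient. *)
Lemma advection_pointwise u v z x :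
  `|\sum_i advection u v i x * z i x| <=
    Num.sqrt (sqgrad v x) * (euclid u x * euclid z x).
Proof.
rewrite /euclid -/(sqlen u x) -/(sqlen z x) -!sqrtrM ?sqgrad_ge0 ?sqlen_ge0 //.
rewrite -sqrtr_sqr ler_wsqrtr //; apply: le_trans (sum2_CauchySchwarz _ _) _.
rewrite mulrA ler_wpM2r ?sqlen_ge0 // mulrC /sqgrad mulr_sumr.
by apply: ler_sum => i _; exact: sum2_CauchySchwarz.
Qed.

Lemma integ_sum2 (F : 'I_2 -> sfield R) :
  (forall i, mu.-integrable setT (EFin \o F i)) ->
  mu.-integrable setT (EFin \o (fun x => \sum_i F i x)) /\
  integ (fun x => \sum_i F i x) = \sum_i integ (F i).
Proof.
move=> IF; rewrite big_ord_recl big_ord1; split; last first.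
  rewrite /integ; under eq_Rintegral do rewrite big_ord_recl big_ord1.
  exact: RintegralD.
rewrite (_ : _ \o _ = (EFin \o F ord0) \+ (EFin \o F (lift ord0 ord0)))%E.
  exact: integrableD.
by apply/funext => x /=; rewrite big_ord_recl big_ord1.
Qed.

Lemma Lfun2_sqrt_sqgrad v : inV v ->
  (fun x => Num.sqrt (sqgrad v x)) \in Lfun mu 2%:E /\
  sqnorm mu (fun x => Num.sqrt (sqgrad v x)) = gradip v v.
Proof.
move=> Vv; have Lw i j := inV_Lfun_wD i j Vv.
have Is i j : mu.-integrable setT (EFin \o (fun x => wD j (v i) x ^+ 2)).
  by case/Lfun2P : (Lw i j).
have [Ig Eg] := integ_sum2 (fun i => (integ_sum2 (Is i)).1).
have [|L S] := Lfun2_sqrt _ (sqgrad_ge0 v) Ig.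
  by apply/measurable_EFinP; exact: measurable_int Ig.
split=> //; rewrite S Eg; apply: eq_bigr => i _.
by rewrite (integ_sum2 (Is i)).2.
Qed.

Lemma integrable_ip u v : vL2 u -> vL2 v ->
  mu.-integrable setT (EFin \o (fun x => \sum_i u i x * v i x)).
Proof.
move=> Lu Lv; apply: (integ_sum2 _).1 => i.
exact: (integrable_mul (Lu i) (Lv i)).
Qed.

(** Hoelder with exponents 2, 4, 4 as two Cauchy-Schwarz steps: [|grad v|] against [|u| |z|], then
    [|u|^2] against [|z|^2]. *)
Lemma ip_advection_Ladyzhenskaya cL u v z : ladyzhenskaya cL ->
  inV u -> inV v -> inV z -> vL2 (advection u v) ->
  ip (advection u v) z ^+ 2 <= gradip v v *
    ((cL * normV u * normH u) * (cL * normV z * normH z)).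
Proof.
move=> hL Vu Vv Vz La.
have [Xu0 Lu Su] := Ladyzhenskaya_sqlen hL Vu.
have [Xz0 Lz Sz] := Ladyzhenskaya_sqlen hL Vz.
have [LF <-] := Lfun2_sqrt_sqgrad Vv.
have Iuz := integrable_mul Lu Lz.
have p0 x : 0 <= sqlen u x * sqlen z x by rewrite mulr_ge0 // sqlen_ge0.
have [|LK SK] := Lfun2_sqrt _ p0 Iuz.
  by apply/measurable_EFinP; exact: measurable_int Iuz.
apply: (@le_trans _ _ (sqnorm mu (fun x => Num.sqrt (sqgrad v x)) *
    sqnorm mu (fun x => Num.sqrt (sqlen u x * sqlen z x)))).
  apply: sqr_integ_le => //; first exact: integrable_ip La (inV_vL2 Vz).
  apply: aeW => x; rewrite sqrtrM ?sqlen_ge0 //; exact: advection_pointwise.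
apply: ler_wpM2l; first exact: sqnorm_ge0.
rewrite SK -[integ _]/(dotp mu (sqlen u) (sqlen z)).
apply: le_trans (ler_norm _) _.
have X0 := mulr_ge0 Xu0 Xz0.
rewrite -(@ler_pXn2r _ 2) ?nnegrE // real_normK ?num_real // exprMn.
apply: le_trans (CauchySchwarz Lu Lz) _.
by apply: ler_pM => //; exact: dotp_ge0.
Qed.

Lemma ip_advection_sup (b : R) u v z : {ae mu, forall x, euclid u x <= b} ->
  inV v -> vL2 z -> vL2 (advection u v) ->
  ip (advection u v) z ^+ 2 <= b ^+ 2 * (gradip v v * ip z z).
Proof.
move=> ub Vv Lz La; have [LF <-] := Lfun2_sqrt_sqgrad Vv.
have Izz := integrable_ip Lz Lz.
have mz := measurable_sqlen Lz.
have [LK SK] := Lfun2_sqrt mz (sqlen_ge0 z) Izz.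
rewrite mulrCA -[ip z z]SK -sqnormZ //.
apply: sqr_integ_le => //.
- exact: integrable_ip.
- exact: Lfun2_scale.
- refine (ae_imply ub _) => x ux; apply: le_trans (advection_pointwise _ _ _ _) _.
  by rewrite ler_wpM2l ?sqrtr_ge0 // ler_wpM2r ?sqrtr_ge0.
Qed.

End AdvectionBounds.

(** * The power estimate *)

Section PowerEstimate.
Variable R : realType.
Implicit Types (u v w z phi : vfield R).

(** The energy form of [Lmu] after integration by parts, which involves first derivatives only. *)
Definition Lform (hnu m : R) N u v : R := hnu * gradip u v + m * ip (PN N u) v.

Lemma ip_Lmu hnu m N u phi : inDA u -> inV phi ->
  ip (Lmu hnu m N u) phi = Lform hnu m N u phi.
Proof.
move=> Du Vphi; have Lphi := inV_vL2 Vphi; have Ls := vL2_stokes Du.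
have LP := @vL2_PN R N u.
rewrite /Lmu ipDl //; [|exact: vL2Z..].
by rewrite !ipZl // ip_stokes.
Qed.

Lemma LformC hnu m N u v : vL2 u -> vL2 v -> Lform hnu m N u v = Lform hnu m N v u.
Proof. by move=> Lu Lv; rewrite /Lform gradipC ip_PNC. Qed.

Lemma gradip_le_Lform hnu m N u : 0 <= m -> inV u ->
  hnu * gradip u u <= Lform hnu m N u u.
Proof.
by move=> m0 Vu; rewrite lerDl mulr_ge0 //; exact/ip_PN_ge0/inV_vL2.
Qed.

(* The low modes of [phi] are controlled by [m * ip (PN N phi) phi], the high
   ones by the spectral gap. *)
Lemma ip_le_Lform hnu m (a K : R) N phi : 0 <= hnu -> 0 < K -> inV phi ->
  K * a <= hnu * m -> K * a <= hnu ^+ 2 * N%:R ^+ 2 ->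
  K * (a * ip phi phi) <= hnu * Lform hnu m N phi phi.
Proof.
move=> h0 K0 Vphi am aN; have Lphi := inV_vL2 Vphi.
have E0 := ip_PN_ge0 N Lphi; have E1 := ip_PN_le N Lphi.
have gap := vector_spectral_gap N Vphi; rewrite /Lform.
move: E0 E1 gap; move: (ip phi phi) (ip _ _) (gradip _ _) => p E G E0 E1 gap.
have h1 : (K * a) * E <= (hnu * m) * E by rewrite ler_wpM2r.
have h2 : (K * a) * (p - E) <= (hnu ^+ 2 * N%:R ^+ 2) * (p - E).
  by rewrite ler_wpM2r // subr_ge0.
have h3 : hnu ^+ 2 * (N%:R ^+ 2 * (p - E)) <= hnu ^+ 2 * G.
  by rewrite ler_wpM2l // sqr_ge0.
lra.
Qed.

(** The geometric mean is replaced by the arithmetic one, so that what remains is linear in the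
    energies. *)
Lemma normr_le_mean (T c p q : R) : 0 <= c -> 0 <= p -> 0 <= q ->
  T ^+ 2 <= c ^+ 2 * (p * q) -> `|T| <= c * ((p + q) / 2).
Proof.
move=> c0 p0 q0 Tpq; have s0 : 0 <= c * ((p + q) / 2).
  by rewrite mulr_ge0 // divr_ge0 // addr_ge0.
rewrite -(@ler_pXn2r _ 2) ?nnegrE // real_normK ?num_real //.
apply: le_trans Tpq _; rewrite exprMn ler_wpM2l ?sqr_ge0 //.
by have := sqr_ge0 (p - q); nra.
Qed.

(** The hypotheses give [32 (a b p r)^2 <= q^2], and [1/32 = 8/256 <= 9/256 = (3/16)^2]. *)
Lemma mul_le_of_absorbed (h a b p q r : R) : 0 <= q -> 0 <= a * b * p * r ->
  32 * ((b ^+ 2 * a ^+ 2) * r ^+ 2) <= h * q -> h * p ^+ 2 <= q ->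
  a * (b * p * r) <= 3 / 16 * q.
Proof.
move=> q0 y0 h1 h2; have s0 : 0 <= 3 / 16 * q by rewrite mulr_ge0.
rewrite !mulrA -(@ler_pXn2r _ 2) ?nnegrE //.
have h3 := ler_wpM2l (sqr_ge0 p) h1; have h4 := ler_wpM2r q0 h2.
rewrite !exprMn; have := sqr_ge0 q; lra.
Qed.

Lemma sqr_mul_le (c p q r s t : R) : 0 <= p * q -> 0 <= p * r ->
  p * q <= c * s -> p * r <= c * t -> p ^+ 2 * (q * r) <= c ^+ 2 * (s * t).
Proof.
move=> q0 r0 qs rt; have := ler_pM q0 r0 qs rt.
by rewrite mulrACA [_ * s * _]mulrACA -!expr2.
Qed.

Lemma normr_add_le (x y s : R) : `|x| <= 4^-1 * (s / 2) ->
  `|y| <= 3 / 16 * (s / 2) -> `|x + y| <= 7 / 32 * s.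
Proof. by have := ler_normD x y; lra. Qed.

Lemma power_ge0 (P q e : R) : 0 <= q -> P = q + e ->
  `|e| <= 7 / 32 * (q + q) -> 0 <= P.
Proof. by move=> q0 -> ; rewrite ler_norml => /andP[]; lra. Qed.

(** Here [q], [r], [s] stand for the energies of [w], of [z], and their mixed product. One test
    gives [P >= 9/16 q], the other [P >= 25/32 r - 7/32 q]; eliminating [q] leaves [P >= 9/16 r]. *)
Lemma power_ge (P q r s e e' : R) : 0 <= q -> P = q + e -> - r = s + e' ->
  s = - P -> `|e| <= 7 / 32 * (q + q) -> `|e'| <= 7 / 32 * (q + r) -> 0 <= r ->
  3^-1 * r <= P.
Proof.
move=> q0 PE rE sE; rewrite !ler_norml => /andP[? ?] /andP[? ?] r0; lra.
Qed.

End PowerEstimate.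

Theorem lemma4p5 (R : realType) (cL cBG : R)
    (hcL : ladyzhenskaya cL) (hcBG : brezis_gallouet cBG)
    (nu hnu mu : R) (hnu_gt0 : 0 < nu) (hhnu_gt0 : 0 < hnu) (hmu_gt0 : 0 < mu)
    (N : nat) (f : vfield R) (hf : inH f)
    (us : vfield R) (hus : inDA us)
    (us_eq : exists b, isB us us b /\ vae (nu *: stokes us + b) f)
    (vs : vfield R) (hvs : inDA vs) (vs_neq0 : ~ vae vs 0)
    (vs_eq : exists b, isB vs vs b /\
      vae (hnu *: stokes vs + b + mu *: PN N vs) (f + mu *: PN N us))
    (ws : vfield R) (hws : inDA ws)
    (ws_eq : exists b, isDB vs ws b /\
      vae (hnu *: stokes ws + mu *: PN N ws + b) (- stokes vs))
    (hmu : Num.max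
       (32 * cL ^+ 2 * normV vs ^+ 2 / hnu)
       (16 * cBG ^+ 2 * normV vs ^+ 2 / hnu
          * (1 + ln (normH (stokes vs) / normH vs))) <= mu)
    (hN : Num.max
       (8 * cL * normV vs / hnu)
       (4 * cBG * normV vs / hnu
          * Num.sqrt (1 + ln (normH (stokes vs) / normH vs))) <= N%:R) :
  - ip (stokes vs) ws >=
    3^-1 * ip (stokes vs) (Lmu_inv hnu mu N (stokes vs)).
Proof.
have Vv : inV vs by case: hvs.
have Vw : inV ws by case: hws.
have Lv := inV_vL2 Vv; have Lw := inV_vL2 Vw.
have LA := vL2_stokes hvs.
have v0 : 0 < normH vs.
  rewrite lt_neqAle sqrtr_ge0 andbT; apply/eqP => v0; apply: vs_neq0.
  by apply: ip_eq0_vae => //; rewrite -normH_sqr -v0 expr0n.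
have vV : normH vs <= normV vs by apply: ler_wsqrtr; exact: Poincare.
have VA : normV vs <= normH (stokes vs) by apply: ler_wsqrtr; exact: ip_le_stokes.
have V0 : 0 < normV vs := lt_le_trans v0 vV.
have A0 : 0 < normH (stokes vs) := lt_le_trans V0 VA.
set l := 1 + ln (_ / normH vs) in hmu hN *.
pose b := cBG * normV vs * Num.sqrt l.
have l1 : 1 <= l.
  by rewrite lerDl ln_ge0 // ler_pdivlMr // mul1r (le_trans vV).
have cL0 : 0 <= cL.
  by have [] := Ladyzhenskaya_sqlen hcL Vv; rewrite -mulrA pmulr_lge0 // mulr_gt0.
(* Brezis-Gallouet has [||v||] inside the logarithm where the hypotheses have [|v|]; as
   [|v| <= ||v||], the latter logarithm is the larger. The sign of [cBG] follows from that of the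
   norm. *)
have [vb cBG0] : (normLp +oo vs <= b%:E)%E /\ 0 <= cBG.
  have := hcBG _ hvs; set s := Num.sqrt _ => h.
  have s1 : 1 <= s.
    rewrite -sqrtr1 ler_wsqrtr // lerDl ln_ge0 //.
    by rewrite ler_pdivlMr // mul1r.
  have c0 : 0 <= cBG.
    have := le_trans (Lnorm_ge0 _ _ _) h.
    by rewrite lee_fin -mulrA pmulr_lge0 // mulr_gt0 // (lt_le_trans ltr01).
  split=> //; apply: le_trans h _; rewrite lee_fin.
  rewrite ler_wpM2l ?mulr_ge0 ?(ltW V0) // ler_wsqrtr // lerD2l.
  rewrite ler_ln ?posrE ?divr_gt0 // ler_wpM2l ?(ltW A0) //.
  by rewrite lef_pV2 ?posrE.
have vsup := ae_euclid_le vb.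
have sl : Num.sqrt l ^+ 2 = l by rewrite sqr_sqrtr // (le_trans ler01).
move: hmu; rewrite ge_max => /andP[hmu1 hmu2].
move: hN; rewrite ge_max => /andP[hN1 hN2].
pose Q := Lform hnu mu N.
pose aL := cL ^+ 2 * gradip vs vs.
have LL phi : inV phi -> 32 * (aL * ip phi phi) <= hnu * Q phi phi.
  move=> Vphi; apply: ip_le_Lform => //; first exact: ltW.
    by move: hmu1; rewrite ler_pdivrMr // /aL -normV_sqr; lra.
  (* Squaring the bound on [N] gives [64 aL <= hnu^2 N^2], which covers the factor 32. *)
  move: hN1; rewrite ler_pdivrMr // => hN1.
  have h8 : (8 * cL * normV vs) ^+ 2 <= (N%:R * hnu) ^+ 2.
    by rewrite lerXn2r ?nnegrE ?mulr_ge0 // ltW.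
  have := sqr_ge0 (cL * normV vs); rewrite /aL -normV_sqr.
  by move: h8; nra.
have BB phi : inV phi -> 16 * (b ^+ 2 * ip phi phi) <= hnu * Q phi phi.
  move=> Vphi; apply: ip_le_Lform => //; first exact: ltW.
    by move: hmu2; rewrite mulrAC ler_pdivrMr // /b !exprMn sl; lra.
  have h4 : 4 * b <= N%:R * hnu.
    by rewrite -ler_pdivrMr //; move: hN2; rewrite mulrAC /b !mulrA.
  have b0 : 0 <= b by rewrite /b !mulr_ge0 // ?ltW // sqrtr_ge0.
  have : (4 * b) ^+ 2 <= (N%:R * hnu) ^+ 2.
    by rewrite lerXn2r ?nnegrE ?mulr_ge0 // ltW.
  by nra.
have QG phi : inV phi -> hnu * gradip phi phi <= Q phi phi.
  by move=> Vphi; apply: gradip_le_Lform; first exact: ltW.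
have Q0 phi : inV phi -> 0 <= Q phi phi.
  by move=> /QG; apply: le_trans; rewrite mulr_ge0 ?gradip_ge0 // ltW.
have QE z phi : inDA z -> inV phi -> ip (Lmu hnu mu N z) phi = Q z phi.
  by move=> Dz Vphi; exact: ip_Lmu.
have QC u v : vL2 u -> vL2 v -> Q u v = Q v u by exact: LformC.
(* What remains uses only coercivity, sign and symmetry of the form and its agreement with [Lmu] on
   D(A). *)
clearbody Q.
have [bb [[b1 [b2 [[La1 Hb1 hb1] [La2 Hb2 hb2] bE]]] wE]] := ws_eq.
have Lb1 : vL2 b1 by case: Hb1.
have Lb2 : vL2 b2 by case: Hb2.
(* Test fields lie in H, so the Leray projection drops out of the pairing. *)
have proj (u c phi : vfield R) : vL2 u -> vL2 c -> inV phi ->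
    (forall psi, inH psi -> ip (u - c) psi = 0) -> ip c phi = ip u phi.
  move=> Lu Lc [Hphi _] /(_ phi Hphi); have Lphi : vL2 phi by case: Hphi.
  rewrite ipDl //; last exact: vL2N.
  by rewrite ipNl // => /eqP; rewrite subr_eq0 => /eqP.
have main phi : inV phi -> - ip (stokes vs) phi =
    Q ws phi + (ip (advection vs ws) phi + ip (advection ws vs) phi).
  move=> Vphi; have Lphi := inV_vL2 Vphi.
  have LLw : vL2 (hnu *: stokes ws + mu *: PN N ws).
    by apply: vL2D; apply: vL2Z; [exact: vL2_stokes|exact: vL2_PN].
  have Lb12 : vL2 (b1 + b2) by exact: vL2D.
  have wE' : vae (hnu *: stokes ws + mu *: PN N ws + (b1 + b2)) (- stokes vs).
    move=> i; refine (ae_and_imply (wE i) (bE i) _) => x /(_ I) w1 /(_ I) b12 _.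
    refine (etrans _ w1).
    exact: (congr1 (+%R ((hnu *: stokes ws + mu *: PN N ws) i x)) (esym b12)).
  rewrite -ipNl // -(ip_vae _ _ _ wE') //; [|exact: vL2D|exact: vL2N].
  rewrite ipDl // (ipDl Lb1 Lb2 Lphi) -[X in ip X phi]/(Lmu hnu mu N ws) QE //.
  by rewrite (proj (advection vs ws) b1) // (proj (advection ws vs) b2).
have e_le phi : inV phi ->
    `|ip (advection vs ws) phi + ip (advection ws vs) phi| <=
      7 / 32 * (Q ws ws + Q phi phi).
  move=> Vphi; have Lphi := inV_vL2 Vphi.
  have Qw := Q0 _ Vw; have Qp := Q0 _ Vphi.
  have e1 : `|ip (advection vs ws) phi| <= 4^-1 * ((Q ws ws + Q phi phi) / 2).
    apply: normr_le_mean => //.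
    apply: le_trans (ip_advection_sup vsup Vw Lphi La1) _.
    have h1 := BB _ Vphi.
    have h2 := QG _ Vw.
    have g0 := gradip_ge0 ws.
    have h3 := ler_wpM2l g0 h1; have h4 := ler_wpM2r Qp h2.
    by lra.
  (* The Ladyzhenskaya bound contains [||v||^2]; one factor [||v||] goes to each of the two fields,
     and each product is absorbed into that field's own energy. *)
  have Ylem psi : inV psi ->
      [/\ 0 <= normV vs * (cL * normV psi * normH psi) &
       normV vs * (cL * normV psi * normH psi) <= 3 / 16 * Q psi psi].
    move=> Vpsi; have Y0 : 0 <= normV vs * (cL * normV psi * normH psi).
      by rewrite !mulr_ge0 ?sqrtr_ge0 // ltW.
    split=> //; apply: (mul_le_of_absorbed (h := hnu)).
    - exact: Q0.
    - by move: Y0; rewrite !mulrA.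
    - by rewrite normV_sqr normH_sqr; exact: LL.
    - by rewrite normV_sqr; exact: QG.
  have e2 : `|ip (advection ws vs) phi| <= 3 / 16 * ((Q ws ws + Q phi phi) / 2).
    apply: normr_le_mean => //.
    have [Yw0 Yw] := Ylem _ Vw; have [Yp0 Yp] := Ylem _ Vphi.
    apply: le_trans (ip_advection_Ladyzhenskaya hcL Vw Vv Vphi La2) _.
    by rewrite -(normV_sqr vs); exact: sqr_mul_le.
  exact: (normr_add_le e1 e2).
have P0 := power_ge0 (Q0 _ Vw) (main _ Vw) (e_le _ Vw).
rewrite /Lmu_inv; set S := [set z | _].
have [[z Sz]|noz] := pselect (exists z, S z); last first.
  (* [Lmu_inv] is then the junk value [0] and only [P >= 0] is needed. *)
  rewrite xgetPN; last by move=> z Sz; apply: noz; exists z.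
  have -> : ip (stokes vs) (fun=> cst 0) = 0.
    rewrite /ip /integ (_ : (fun x => _) = fun=> 0) ?Rintegral_cst ?mul0r //.
    by apply/funext => x; rewrite big1 // => i _; rewrite mulr0.
  by rewrite mulr0.
have [Dz zE] := xgetPex (fun=> cst 0) (ex_intro _ z Sz) => {z Sz}.
move: Dz zE; set z := xget _ _ => Dz zE.
have Vz : inV z by case: Dz.
have Lz := inV_vL2 Vz.
have Lz' : vL2 (Lmu hnu mu N z).
  by apply: vL2D; apply: vL2Z; [exact: vL2_stokes|exact: vL2_PN].
have Az phi : inV phi -> ip (stokes vs) phi = Q z phi.
  by move=> Vphi; rewrite -(ip_vae Lz' LA (inV_vL2 Vphi) zE) QE.
(* Symmetry of the form: [(L w, z) = (L z, w) = (A v, w) = -P], which links the two tests. *)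
have zw : Q ws z = - - ip (stokes vs) ws by rewrite opprK (Az _ Vw) QC.
have := main _ Vz; rewrite (Az _ Vz) => mainz.
exact: (power_ge (Q0 _ Vw) (main _ Vw) mainz zw (e_le _ Vw) (e_le _ Vz) (Q0 _ Vz)).
Qed.
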